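(* Let $G$ be a graph with $n$ vertices and $m$ edges, and let $G'$ be a spanning subgraph of $G$ with $m'$ edges that is constructed by an algorithm starting from the empty edge set and adding edges one at a time; let $d'=m'/n$ be the average degree of $G'$. Then the degree sequence of $G'$ can be maintained dynamically during this construction (so that the current degree in $G'$ of every vertex is updated after each edge insertion) in $O(m+n)$ total time using $O(n(\lg d'+\lg\lg n))$ bits of construction space. Moreover, the final degree sequence can be stored using $O(n\lg d')$ bits so that the degree of any vertex in $G'$ can be returned in $O(1)$ time.
   Context: Model: word RAM. The degree of a vertex $v$ in $G'$ is the number of edges of $G'$ incident to $v$ (which may differ from its degree in $G$).
   Formalization: Here lg x means max(1, log₂ x), since for d' ≤ 1 the bound O(n lg d') would be zero, negative or undefined; graphs are simple and undirected, and the word RAM has word length w with 2 lg n ≤ w = O(lg n) (and w at least a constant). *)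

(* Defs.v *)
From HB Require Import structures.
From mathcomp Require Import all_boot all_order all_algebra.
From mathcomp Require Import reals exp.

Set Implicit Arguments.
Unset Strict Implicit.
Unset Printing Implicit Defensive.

Import Order.TTheory GRing.Theory Num.Theory.

(* Vertices are the word-RAM identifiers 0, ..., n-1.  Subgraphs share the vertex
   set 'I_n, hence are spanning. *)
Record sgraph (n : nat) := SGraph {
  edges :> {set {set 'I_n}};
  edges_pairs : forall e, e \in edges -> #|e| = 2 }.

Definition degree n (F : {set {set 'I_n}}) (v : 'I_n) : nat :=
  #|[set e in F | v \in e]|.

Definition spanning_subgraph n (G' G : sgraph n) : Prop :=
  edges G' \subset edges G.

(* m'/n, i.e. half of the mean of the vertex degrees. *)
Definition avg_degree (R : realType) n (G' : sgraph n) : R :=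
  (#|edges G'|%:R / n%:R)%R.

(* Binary logarithm, clamped below at 1 as is implicit in space bounds: without the
   clamp "n lg d'" would be zero or negative for d' <= 1. *)
Definition lg (R : realType) (x : R) : R := Num.max 1%R (ln x / ln 2)%R.

(* Word RAM with w-bit words.  Registers and memory cells hold naturals below 2^w.
   A program is a structured command over finitely many registers; it is fixed once
   and for all, independently of w and of the input. *)
Inductive binop :=
  Add | Sub | Mul | Div | Mod | And | Or | Xor | Shl | Shr | Ltn | Eqn.

Inductive expr :=
  | Cst (k : nat)
  | Reg (x : nat)
  | Bin (o : binop) (e1 e2 : expr)
  | Read (a : expr).

Inductive cmd :=
  | Skip
  | Assign (x : nat) (e : expr)
  | Write (a e : expr)
  | Seq (c1 c2 : cmd)
  | If (e : expr) (c1 c2 : cmd)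
  | While (e : expr) (c : cmd).

Definition memory := nat -> nat.

Record state := State { regs : nat -> nat; mem : memory }.

Definition update (f : nat -> nat) (i x : nat) : nat -> nat :=
  fun j => if j == i then x else f j.

(* Division by zero yields 0, and a modulo 0 is a. *)
Definition binop_sem (w : nat) (o : binop) (a b : nat) : nat :=
  match o with
  | Add => (a + b) %% 2 ^ w
  | Sub => (a + 2 ^ w - b) %% 2 ^ w
  | Mul => (a * b) %% 2 ^ w
  | Div => a %/ b
  | Mod => a %% b
  | And => Nat.land a b
  | Or => Nat.lor a b
  | Xor => Nat.lxor a b
  | Shl => (a * 2 ^ b) %% 2 ^ w
  | Shr => a %/ 2 ^ b
  | Ltn => a < b
  | Eqn => a == b
  end.

(* S is the number of memory cells available: an access at an address >= S is an
   error.  S is not visible to the program. *)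
Fixpoint eval (w S : nat) (s : state) (e : expr) : option nat :=
  match e with
  | Cst k => Some (k %% 2 ^ w)
  | Reg x => Some (regs s x)
  | Bin o e1 e2 =>
      if eval w S s e1 is Some a then
        if eval w S s e2 is Some b then Some (binop_sem w o a b) else None
      else None
  | Read e1 =>
      if eval w S s e1 is Some a then
        if a < S then Some (mem s a) else None
      else None
  end.

(* One time unit for every operation, memory access, register access or constant. *)
Fixpoint cost (e : expr) : nat :=
  match e with
  | Cst _ | Reg _ => 1
  | Bin _ e1 e2 => (cost e1 + cost e2).+1
  | Read e1 => (cost e1).+1
  end.

(* exec w S c s t s': started in s, c halts in s' after t time units, all its memory
   accesses being to the first S cells. *)
Inductive exec (w S : nat) : cmd -> state -> nat -> state -> Prop :=
  | exec_skip s : exec w S Skip s 0 s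
  | exec_assign s x e a : eval w S s e = Some a ->
      exec w S (Assign x e) s (cost e).+1 (State (update (regs s) x a) (mem s))
  | exec_write s e1 e2 a b : eval w S s e1 = Some a -> eval w S s e2 = Some b ->
      a < S ->
      exec w S (Write e1 e2) s (cost e1 + cost e2).+1
        (State (regs s) (update (mem s) a b))
  | exec_seq c1 c2 s s1 s2 t1 t2 :
      exec w S c1 s t1 s1 -> exec w S c2 s1 t2 s2 ->
      exec w S (Seq c1 c2) s (t1 + t2) s2
  | exec_if e c1 c2 s s' a t : eval w S s e = Some a ->
      exec w S (if a != 0 then c1 else c2) s t s' ->
      exec w S (If e c1 c2) s ((cost e).+1 + t) s'
  | exec_while_done e c s : eval w S s e = Some 0 ->
      exec w S (While e c) s (cost e).+1 s
  | exec_while_step e c s s1 s2 a t1 t2 : eval w S s e = Some a -> a != 0 ->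
      exec w S c s t1 s1 -> exec w S (While e c) s1 t2 s2 ->
      exec w S (While e c) s ((cost e).+1 + t1 + t2) s2.

Lemma exec_det w S c s t1 s1 t2 s2 :
  exec w S c s t1 s1 -> exec w S c s t2 s2 -> t1 = t2 /\ s1 = s2.
Proof.
move=> E1; elim: E1 t2 s2 => {c s t1 s1}.
- by move=> s t2 s2 E; inversion E.
- by move=> s x e a Ha t2 s2 E; inversion E; subst; split; congruence.
- by move=> s e1 e2 a b Ha Hb _ t2 s2 E; inversion E; subst; split; congruence.
- move=> c1 c2 s s1 s2 t1 t2 _ IH1 _ IH2 t s' E.
  inversion E as [| | |? ? ? ? ? ? ? X1 X2| | |]; subst.
  by case: (IH1 _ _ X1) => -> Es; subst; case: (IH2 _ _ X2) => -> ->.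
- move=> e c1 c2 s s' a t Ha _ IH t2 s2 E.
  inversion E as [| | | |? ? ? ? ? b ? Hb X| |]; subst.
  by move: Hb X; rewrite Ha => -[<-] /IH [-> ->].
- move=> e c s H t2 s2 E; inversion E as [| | | | | |? ? ? ? ? b ? ? Hb b0]; subst => //.
  by move: Hb b0; rewrite H => -[<-].
- move=> e c s s1 s2 a t1 t2 Ha a0 _ IH1 _ IH2 t s' E.
  inversion E as [| | | | |? ? ? Hb|? ? ? ? ? b ? ? Hb b0 X1 X2]; subst.
    by move: Hb a0; rewrite Ha => -[->].
  by case: (IH1 _ _ X1) => -> Es; subst; case: (IH2 _ _ X2) => -> ->.
Qed.

Definition wordmem (w : nat) (M : memory) : Prop := forall i, M i < 2 ^ w.

(* The arguments are passed in registers 0, 1, ...; all other registers start at 0,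
   so that only the memory persists between calls.  The result is register 0. *)
Definition call (w S : nat) (c : cmd) (args : seq nat) (M : memory)
    (t : nat) (M' : memory) (res : nat) : Prop :=
  exists rs, exec w S c (State (nth 0 args) M) t (State rs M') /\ rs 0 = res.

(* Words of Theta(lg n) bits.  n ^ 2 bounds n + 2m, so that the adjacency lists of
   any simple graph on n vertices are addressable; w0 is the width needed for the
   constants of a program, and kappa is the constant in w = O(lg n). *)
Definition word_size (w0 kappa n w : nat) : bool :=
  [&& w0 <= w, n ^ 2 <= 2 ^ w & w <= kappa * (trunc_log 2 n).+1].

Record dynamic_degrees := DynamicDegrees {
  dd_init : cmd;     (* arguments: n, w *)
  dd_insert : cmd;   (* arguments: the endpoints of the new edge *)
  dd_degree : cmd }. (* argument: a vertex; result: its current degree *)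

Inductive dyn_op (n : nat) := Insert of 'I_n & 'I_n | Query of 'I_n.

Definition inserted n (ops : seq (dyn_op n)) : seq {set 'I_n} :=
  pmap (fun o => if o is Insert u v then Some [set u; v] else None) ops.

Definition nqueries n (ops : seq (dyn_op n)) : nat :=
  count (fun o => if o is Query _ then true else false) ops.

(* ops adds exactly the edges of G', one at a time, in some order. *)
Definition builds n (ops : seq (dyn_op n)) (G' : sgraph n) : Prop :=
  perm_eq (inserted ops) (enum (edges G')).

(* maintains D w S F M ops t: from memory M, with F the current edge set, the
   operations are served online, in total time t and within the first S cells, and
   every query returns the degree in the edge set current at that moment. *)
Inductive maintains (D : dynamic_degrees) (w S n : nat) :
    {set {set 'I_n}} -> memory -> seq (dyn_op n) -> nat -> Prop :=
  | maintains_nil F M : maintains D w S F M [::] 0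
  | maintains_insert F M M1 u v ops t1 t2 r :
      call w S (dd_insert D) [:: val u; val v] M t1 M1 r ->
      maintains D w S ([set u; v] |: F) M1 ops t2 ->
      maintains D w S F M (Insert u v :: ops) (t1 + t2)
  | maintains_query F M M1 v ops t1 t2 :
      call w S (dd_degree D) [:: val v] M t1 M1 (degree F v) ->
      maintains D w S F M1 ops t2 ->
      maintains D w S F M (Query v :: ops) (t1 + t2).

(* The whole run, initialization included, from the empty edge set and arbitrary
   initial memory contents. *)
Definition maintains_from_empty (D : dynamic_degrees) (w S n : nat)
    (ops : seq (dyn_op n)) (t : nat) : Prop :=
  forall M0, wordmem w M0 -> exists M1 t1 t2 r,
    [/\ call w S (dd_init D) [:: n; w] M0 t1 M1 r,
        maintains D w S set0 M1 ops t2 & t1 + t2 <= t].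

(* M stores the degrees of G' in its first S cells: Q answers every degree query in
   time at most t, reading only these cells and leaving M intact. *)
Definition stores_degrees (Q : cmd) (w S n : nat) (G' : sgraph n) (M : memory)
    (t : nat) : Prop :=
  wordmem w M /\
  forall v : 'I_n, exists2 t', t' <= t &
    call w S Q [:: val v] M t' M (degree (edges G') v).

(* Main.v *)
Require Import Defs.
From mathcomp Require Import all_boot all_order all_algebra.
From mathcomp Require Import reals exp.
From mathcomp Require Import zify.

(* Dynamic part.  The vertices are cut into blocks of w/2, and all degrees of a block are
   kept in counters of one common width b, in b cells.  When a counter overflows, the block
   is copied to fresh memory with b doubled.  The first width has 2^b >= w, so a copy, which
   takes O(w) time, is paid for by the 2^b insertions at the vertex that overflowed.  A block
   whose width has been doubled beyond b has degree sum sigma >= 2^b, hence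
   b <= s + sigma / 2^s for every s; with 2^s about d' w the sum over the blocks gives
   O(n (lg d' + lg lg n)) bits, and doubling makes the abandoned copies a geometric series.

   Static part.  The lg d' + O(1) low bits of each degree are packed in an array; the high
   parts g have sum O(n).  With K = Theta(lg n), the vertices are cut into O(n / K) classes of
   consecutive vertices in which the g-values, except possibly the last one, sum to less than
   K.  The class of a vertex is found from the number of classes begun before its group of K
   vertices and a K-bit word marking the beginnings inside the group; the unary code of a
   class has at most 3K bits.  Both words are decoded by tables of size n^(1-Omega(1)). *)

Import Order.TTheory GRing.Theory Num.Theory.

Set Implicit Arguments.
Unset Strict Implicit.
Unset Printing Implicit Defensive.

Local Notation cells := Defs.mem.

(** * Running programs *)

Section Ram.

Variables w S : nat.

(** Total correctness with a time bound. The postcondition is a predicate on states, so it can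
    itself be a [runs] statement about the rest of the program. *)
Definition runs (c : cmd) (s : state) (T : nat) (P : state -> Prop) : Prop :=
  exists t s', [/\ exec w S c s t s', t <= T & P s'].

Lemma runs_weaken c s T T' (P P' : state -> Prop) :
  runs c s T P -> T <= T' -> (forall s', P s' -> P' s') -> runs c s T' P'.
Proof.
move=> [t [s' [E le_t Ps]]] leT PP'; exists t, s'; split=> //; last exact: PP'.
exact: leq_trans leT.
Qed.

Lemma runs_skip s (P : state -> Prop) : P s -> runs Skip s 0 P.
Proof. by move=> Ps; exists 0, s; split=> //; constructor. Qed.

Lemma runs_assign s x e a (P : state -> Prop) :
  eval w S s e = Some a -> P (State (update (regs s) x a) (cells s)) ->
  runs (Assign x e) s (cost e).+1 P.
Proof. by move=> Ha Ps; do 2!eexists; split; [apply: exec_assign Ha| |]. Qed.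

Lemma runs_write s e1 e2 a b (P : state -> Prop) :
  eval w S s e1 = Some a -> eval w S s e2 = Some b -> a < S ->
  P (State (regs s) (update (cells s) a b)) ->
  runs (Write e1 e2) s (cost e1 + cost e2).+1 P.
Proof. by move=> Ha Hb aS Ps; do 2!eexists; split; [apply: exec_write Ha Hb aS| |]. Qed.

Lemma runs_seq c1 c2 s T1 T2 (P : state -> Prop) :
  runs c1 s T1 (fun s1 => runs c2 s1 T2 P) -> runs (Seq c1 c2) s (T1 + T2) P.
Proof.
move=> [t1 [s1 [E1 le1 [t2 [s2 [E2 le2 Ps]]]]]].
by exists (t1 + t2), s2; split=> //; [apply: exec_seq E1 E2 | apply: leq_add].
Qed.

Lemma runs_if e c1 c2 s a T (P : state -> Prop) :
  eval w S s e = Some a -> runs (if a != 0 then c1 else c2) s T P ->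
  runs (If e c1 c2) s ((cost e).+1 + T) P.
Proof.
move=> Ha [t [s' [E le_t Ps]]]; exists ((cost e).+1 + t), s'; split=> //.
  exact: exec_if Ha E.
by rewrite leq_add2l.
Qed.

(** The invariant is indexed by the number of completed iterations and [N] is their exact number, so
    it proves termination and time together. *)
Lemma runs_while e c (I : nat -> state -> Prop) N T s :
  (forall k s', k < N -> I k s' ->
     exists2 a, eval w S s' e = Some a & a != 0 /\ runs c s' T (I k.+1)) ->
  (forall s', I N s' -> eval w S s' e = Some 0) ->
  I 0 s -> runs (While e c) s (N * ((cost e).+1 + T) + (cost e).+1) (I N).
Proof.
(* Generalized to a start after [k] iterations, for induction on the number [d] of those that
   remain. *)
move=> Istep Iend; have {Istep}: forall d k s', N = k + d -> I k s' ->
  runs (While e c) s' (d * ((cost e).+1 + T) + (cost e).+1) (I N); last first.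
  by move=> H I0; apply: (H N 0).
elim=> [|d IHd] k s' eqN Ik.
  rewrite addn0 in eqN; subst k; exists (cost e).+1, s'; split=> //.
  exact/exec_while_done/Iend.
have [|a Ha [a0 [t1 [s1 [E1 le1 I1]]]]] := Istep k s' _ Ik; first by lia.
have [|t2 [s2 [E2 le2 I2]]] := IHd k.+1 s1 _ I1; first by lia.
exists ((cost e).+1 + t1 + t2), s2; split=> //; first exact: exec_while_step Ha a0 E1 E2.
by rewrite mulSn; lia.
Qed.

(** The side conditions of this and the following rules exclude wrap-around, so that machine
    arithmetic agrees with arithmetic on naturals. *)
Lemma eval_cst s k : k < 2 ^ w -> eval w S s (Cst k) = Some k.
Proof. by move=> kw; rewrite /= modn_small. Qed.

Lemma eval_reg s x a : regs s x = a -> eval w S s (Reg x) = Some a.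
Proof. by move=> <-. Qed.

Lemma eval_read s e a b :
  eval w S s e = Some a -> a < S -> cells s a = b -> eval w S s (Read e) = Some b.
Proof. by move=> /= -> -> ->. Qed.

Lemma eval_add s e1 e2 a b :
  eval w S s e1 = Some a -> eval w S s e2 = Some b -> a + b < 2 ^ w ->
  eval w S s (Bin Add e1 e2) = Some (a + b).
Proof. by move=> /= -> -> ltw; rewrite modn_small. Qed.

Lemma eval_sub s e1 e2 a b :
  eval w S s e1 = Some a -> eval w S s e2 = Some b -> b <= a -> a < 2 ^ w ->
  eval w S s (Bin Defs.Sub e1 e2) = Some (a - b).
Proof.
by move=> /= -> -> leba ltw; rewrite addnC -addnBA // modnDl modn_small //; lia.
Qed.

Lemma eval_mul s e1 e2 a b :
  eval w S s e1 = Some a -> eval w S s e2 = Some b -> a * b < 2 ^ w ->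
  eval w S s (Bin Mul e1 e2) = Some (a * b).
Proof. by move=> /= -> -> ltw; rewrite modn_small. Qed.

Lemma eval_div s e1 e2 a b :
  eval w S s e1 = Some a -> eval w S s e2 = Some b ->
  eval w S s (Bin Div e1 e2) = Some (a %/ b).
Proof. by move=> /= -> ->. Qed.

Lemma eval_mod s e1 e2 a b :
  eval w S s e1 = Some a -> eval w S s e2 = Some b ->
  eval w S s (Bin Mod e1 e2) = Some (a %% b).
Proof. by move=> /= -> ->. Qed.

Lemma eval_shl s e1 e2 a b :
  eval w S s e1 = Some a -> eval w S s e2 = Some b -> a * 2 ^ b < 2 ^ w ->
  eval w S s (Bin Shl e1 e2) = Some (a * 2 ^ b).
Proof. by move=> /= -> -> ltw; rewrite modn_small. Qed.

Lemma eval_shr s e1 e2 a b :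
  eval w S s e1 = Some a -> eval w S s e2 = Some b ->
  eval w S s (Bin Shr e1 e2) = Some (a %/ 2 ^ b).
Proof. by move=> /= -> ->. Qed.

Lemma eval_ltn s e1 e2 a b :
  eval w S s e1 = Some a -> eval w S s e2 = Some b ->
  eval w S s (Bin Ltn e1 e2) = Some (a < b : nat).
Proof. by move=> /= -> ->. Qed.

Lemma eval_eqn s e1 e2 a b :
  eval w S s e1 = Some a -> eval w S s e2 = Some b ->
  eval w S s (Bin Eqn e1 e2) = Some (a == b : nat).
Proof. by move=> /= -> ->. Qed.

End Ram.

Lemma update_eq f i x : update f i x i = x.
Proof. by rewrite /update eqxx. Qed.

Lemma update_neq f i x j : j != i -> update f i x j = f j.
Proof. by rewrite /update => /negPf ->. Qed.

(** * Packed counters *)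

Definition field (W off b : nat) : nat := (W %/ 2 ^ off) %% 2 ^ b.

Lemma field_lt W off b : field W off b < 2 ^ b.
Proof. by rewrite ltn_mod expn_gt0. Qed.

(** The added term is a multiple of [2 ^ (off + b)], invisible below that position. *)
Lemma field_add_above W x off off' b :
  off + b <= off' -> field (W + x * 2 ^ off') off b = field W off b.
Proof.
move=> /subnK; set k := off' - _ => <-.
have -> : x * 2 ^ (k + (off + b)) = x * 2 ^ k * 2 ^ b * 2 ^ off by rewrite !expnD; lia.
by rewrite /field addnC divnMDl ?expn_gt0 // modnMDl.
Qed.

Lemma field_top W x off b :
  W < 2 ^ off -> x < 2 ^ b -> field (W + x * 2 ^ off) off b = x.
Proof.
move=> Wlt xlt; rewrite /field addnC divnMDl ?expn_gt0 // divn_small // addn0.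
by rewrite modn_small.
Qed.

Lemma field_incr W off b :
  (field W off b).+1 < 2 ^ b -> field (W + 2 ^ off) off b = (field W off b).+1.
Proof.
rewrite /field => lt; rewrite -[X in W + X]mul1n addnC divnMDl ?expn_gt0 //.
by rewrite add1n -addn1 -modnDml addn1 modn_small.
Qed.

(** With [q = W %/ 2 ^ off], the increment of [q] stays below the next multiple of [2 ^ b], so
    nothing propagates out of the field. *)
Lemma add_no_carry W off b e :
  (field W off b).+1 < 2 ^ b -> off + b <= e -> (W + 2 ^ off) %/ 2 ^ e = W %/ 2 ^ e.
Proof.
move=> lt le; rewrite -(subnKC le) !expnD !divnMA; congr (_ %/ _).
rewrite -[X in W + X]mul1n addnC divnMDl ?expn_gt0 // add1n.
move: lt; rewrite /field; set q := W %/ _ => lt.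
by rewrite {1}(divn_eq q (2 ^ b)) -addnS divnMDl ?expn_gt0 // (divn_small lt) addn0.
Qed.

(** Fields above see no carry; fields below see a multiple of a power beyond them. *)
Lemma field_incr_other W off off' b :
  (field W off b).+1 < 2 ^ b -> off + b <= off' \/ off' + b <= off ->
  field (W + 2 ^ off) off' b = field W off' b.
Proof.
move=> lt [le|le]; first by rewrite /field (add_no_carry lt le).
by rewrite -[X in W + X]mul1n field_add_above.
Qed.

(** Without a carry the bits from position [w] on stay zero. *)
Lemma incr_lt_pow W off b w :
  (field W off b).+1 < 2 ^ b -> off + b <= w -> W < 2 ^ w -> W + 2 ^ off < 2 ^ w.
Proof.
move=> lt le Wlt; have := add_no_carry lt le; rewrite (divn_small Wlt) => /eqP.
by rewrite eqn0Ngt divn_gt0 ?expn_gt0 // -ltnNge.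
Qed.

(* A block at address [A] with counters of [b] bits has its width in cell [A] and the counter
   of its [i]-th vertex in cell [A + 1 + i %% b], at the bit position [i - i %% b], a multiple
   of [b].  For [b = 0] the counter is [_ %% 1 = 0], whatever the cell holds. *)
Definition slot (A b i : nat) : nat := A + 1 + i %% b.
Definition shift (b i : nat) : nat := i - i %% b.
Definition counter (M : memory) (A b i : nat) : nat := field (M (slot A b i)) (shift b i) b.

(** Vertices that share a cell have disjoint fields: with equal remainders their shifts are distinct
    multiples of [b]. For [b = 0] the hypotheses conflict, since [i %% 0 = i]. *)
Lemma shift_sep b i i' :
  i %% b = i' %% b -> i < i' -> shift b i + b <= shift b i'.
Proof.
rewrite /shift => e lt; have [->|b0] := posnP b; first by rewrite !modn0; lia.
move: (divn_eq i b) (divn_eq i' b); rewrite e.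
move: (i %/ b) (i' %/ b) (i' %% b) => q q' r E E'.
have : q < q' by rewrite ltnNge; apply/negP => /leq_mul/(_ (leqnn b)); lia.
by move=> /leq_mul/(_ (leqnn b)); rewrite mulSn; lia.
Qed.

(** The reason for [w %/ 2] vertices per block: for [b >= w %/ 2] the shift is 0, otherwise shift
    and width are both at most [w %/ 2]. *)
Lemma shift_fits w b i : b <= w -> i < w %/ 2 -> shift b i + b <= w.
Proof.
rewrite /shift => bw iB; have [le|lt] := leqP (w %/ 2) b.
  by rewrite modn_small; lia.
by lia.
Qed.

Definition slot_expr (A b i : expr) : expr :=
  Bin Add (Bin Add A (Cst 1)) (Bin Mod i b).
Definition shift_expr (b i : expr) : expr := Bin Defs.Sub i (Bin Mod i b).
Definition counter_expr (A b i : expr) : expr :=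
  Bin Mod (Bin Shr (Read (slot_expr A b i)) (shift_expr b i)) (Bin Shl (Cst 1) b).

Section CounterExpr.

Variables (w S : nat) (s : state) (eA eb ei : expr) (A b i : nat).
Hypothesis S_le : S <= 2 ^ w.
Hypothesis evA : eval w S s eA = Some A.
Hypothesis evb : eval w S s eb = Some b.
Hypothesis evi : eval w S s ei = Some i.
Hypothesis slot_lt : slot A b i < S.
Hypothesis i_lt : i < 2 ^ w.
Hypothesis w_gt0 : 0 < w.

Lemma one_lt_pow : 1 < 2 ^ w.
Proof. by rewrite -{1}(expn0 2) ltn_exp2l. Qed.

Lemma eval_slot : eval w S s (slot_expr eA eb ei) = Some (slot A b i).
Proof.
have := one_lt_pow; move: slot_lt; rewrite /slot => lt lt1.
apply: eval_add; last by lia.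
  by apply: eval_add evA _ _; [apply: eval_cst | lia].
exact: eval_mod.
Qed.

Lemma eval_shift : eval w S s (shift_expr eb ei) = Some (shift b i).
Proof. by apply: eval_sub => //; [apply: eval_mod | apply: leq_mod]. Qed.

Lemma eval_counter : b < w ->
  eval w S s (counter_expr eA eb ei) = Some (counter (cells s) A b i).
Proof.
move=> bw; apply: eval_mod.
  apply: eval_shr; last exact: eval_shift.
  exact: eval_read eval_slot _ _.
rewrite -[2 ^ b]mul1n; apply: eval_shl => //; first exact: eval_cst one_lt_pow.
by rewrite mul1n ltn_exp2l.
Qed.

End CounterExpr.

(* Cell 0 holds the number w/2 of vertices per block, cell 1 the initial width, cell 2 the
   first free address, and cell 3 is a shared block of width 0, to which all entries of the
   directory, in the cells from 4 on, point initially. *)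
Definition locate : cmd :=
  Seq (Assign 2 (Bin Div (Reg 0) (Read (Cst 0))))
  (Seq (Assign 3 (Bin Mod (Reg 0) (Read (Cst 0))))
  (Seq (Assign 4 (Read (Bin Add (Reg 2) (Cst 4))))
       (Assign 5 (Read (Reg 4))))).

(* The first visit to a destination cell, at [i < b], must discard its old contents. *)
Definition copy_loop : cmd :=
  While (Bin Ltn (Reg 8) (Read (Cst 0)))
    (Seq (Write (slot_expr (Reg 6) (Reg 7) (Reg 8))
            (Bin Add
              (Bin Mul (Bin Eqn (Bin Ltn (Reg 8) (Reg 7)) (Cst 0))
                       (Read (slot_expr (Reg 6) (Reg 7) (Reg 8))))
              (Bin Shl (counter_expr (Reg 4) (Reg 5) (Reg 8))
                       (shift_expr (Reg 7) (Reg 8)))))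
         (Assign 8 (Bin Add (Reg 8) (Cst 1)))).

(** Registers 6 and 7 receive the new address and the new width. The product with the equality test
    yields the initial width in place of the double of 0. *)
Definition grow : cmd :=
  Seq (Assign 6 (Read (Cst 2)))
  (Seq (Assign 7 (Bin Add (Bin Add (Reg 5) (Reg 5))
                          (Bin Mul (Read (Cst 1)) (Bin Eqn (Reg 5) (Cst 0)))))
  (Seq (Write (Reg 6) (Reg 7))
  (Seq (Assign 8 (Cst 0))
  (Seq copy_loop
  (Seq (Write (Bin Add (Reg 2) (Cst 4)) (Reg 6))
  (Seq (Write (Cst 2) (Bin Add (Bin Add (Reg 6) (Cst 1)) (Reg 7)))
  (Seq (Assign 4 (Reg 6))
       (Assign 5 (Reg 7))))))))).

Definition bump : cmd :=
  Write (slot_expr (Reg 4) (Reg 5) (Reg 3))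
    (Bin Add (Read (slot_expr (Reg 4) (Reg 5) (Reg 3)))
             (Bin Shl (Cst 1) (shift_expr (Reg 5) (Reg 3)))).

(** A block of width 0 always passes the overflow test, as [0 + 1 = 2 ^ 0]; the first insertion at a
    block thus allocates it. *)
Definition incr : cmd :=
  Seq locate
  (Seq (If (Bin Eqn (Bin Add (counter_expr (Reg 4) (Reg 5) (Reg 3)) (Cst 1))
                    (Bin Shl (Cst 1) (Reg 5)))
           grow Skip)
       bump).

(** The first loop finds the least positive width [b] with [2 ^ b >= w], the second fills the
    directory; all other cells keep their arbitrary contents. *)
Definition degrees_init : cmd :=
  Seq (Assign 2 (Cst 1))
  (Seq (While (Bin Ltn (Bin Shl (Cst 1) (Reg 2)) (Reg 1))
          (Assign 2 (Bin Add (Reg 2) (Cst 1))))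
  (Seq (Write (Cst 0) (Bin Div (Reg 1) (Cst 2)))
  (Seq (Write (Cst 1) (Reg 2))
  (Seq (Write (Cst 3) (Cst 0))
  (Seq (Assign 3 (Bin Add (Bin Div (Reg 0) (Read (Cst 0))) (Cst 1)))
  (Seq (Write (Cst 2) (Bin Add (Cst 4) (Reg 3)))
  (Seq (Assign 4 (Cst 0))
       (While (Bin Ltn (Reg 4) (Reg 3))
         (Seq (Write (Bin Add (Reg 4) (Cst 4)) (Cst 3))
              (Assign 4 (Bin Add (Reg 4) (Cst 1)))))))))))).

(** Register 1 keeps the second endpoint during the first [incr], hence the clauses on register 1 in
    the specifications below. *)
Definition degrees : dynamic_degrees :=
  DynamicDegrees degrees_init
    (Seq incr (Seq (Assign 0 (Reg 1)) incr))
    (Seq locate (Assign 0 (counter_expr (Reg 4) (Reg 5) (Reg 3)))).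

Lemma counter_width0 M A i : counter M A 0 i = 0.
Proof. by rewrite /counter /field expn0 modn1. Qed.

Lemma counter_lt M A b i : counter M A b i < 2 ^ b.
Proof. exact: field_lt. Qed.

(** * Correctness of copying a block to wider counters *)

Section CopyLoop.

Variables (w S : nat) (st : state) (A b A' b' : nat).
Hypothesis S_le : S <= 2 ^ w.
Hypothesis A_reg : regs st 4 = A.
Hypothesis b_reg : regs st 5 = b.
Hypothesis A'_reg : regs st 6 = A'.
Hypothesis b'_reg : regs st 7 = b'.
Hypothesis k_reg : regs st 8 = 0.
Hypothesis B_cell : cells st 0 = w %/ 2.
Hypothesis b_le : b <= b'.
Hypothesis b'_gt0 : 0 < b'.
Hypothesis b'_lt : b' < w.
Hypothesis src_lt : forall i, i < w %/ 2 -> slot A b i < S.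
Hypothesis src_below : 0 < b -> forall i, slot A b i < A'.
Hypothesis dst_lt : A' + b' < S.

Let copied k st' :=
  [/\ forall r, r != 8 -> regs st' r = regs st r,
      regs st' 8 = k,
      forall a, a <= A' -> cells st' a = cells st a,
      forall i, i < k -> counter (cells st') A' b' i = counter (cells st) A b i /\
                         cells st' (slot A' b' i) < 2 ^ w
    & forall i, k <= i -> i %% b' < k -> cells st' (slot A' b' i) < 2 ^ shift b' i].

(** A source of positive width lies below [A']; a source of width 0 has only zero counters, whatever
    the memory holds. *)
Lemma source_unchanged M i :
  (forall a, a <= A' -> M a = cells st a) -> counter M A b i = counter (cells st) A b i.
Proof.
move=> eqM; have [b0|b_gt0] := posnP b; first by rewrite b0 !counter_width0.
by rewrite /counter eqM // ltnW // src_below.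
Qed.

Lemma dst_slot i : A' < slot A' b' i < S.
Proof. by rewrite /slot; have := ltn_pmod i b'_gt0; move: (i %% b') => r; lia. Qed.

Lemma copy_loop_runs : runs w S copy_loop st (w %/ 2 * 60 + 60) (fun st' =>
  [/\ forall r, r != 8 -> regs st' r = regs st r,
      forall a, a <= A' -> cells st' a = cells st a
    & forall i, i < w %/ 2 -> counter (cells st') A' b' i = counter (cells st) A b i /\
                              cells st' (slot A' b' i) < 2 ^ w]).
Proof.
have w0 : 0 < w by lia.
have one := one_lt_pow w0.
have wlt : w < 2 ^ w by apply: ltn_expl.
eapply runs_weaken; first eapply (@runs_while _ _ _ _ copied (w %/ 2)); last first.
- by move=> st' [].
- shelve.
- by split=> //.
- move=> st' [sameR kR sameM _ _].
  have := @eval_ltn w S st' (Reg 8) (Read (Cst 0)) (w %/ 2) (w %/ 2).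
  rewrite ltnn; apply; first exact: eval_reg.
  apply: eval_read (eval_cst _ _ _) _ _; [lia| lia |by rewrite sameM].
- move=> k st' kB [sameR kR sameM done fresh].
  have evk : eval w S st' (Reg 8) = Some k by apply: eval_reg.
  have evA : eval w S st' (Reg 4) = Some A by apply: eval_reg; rewrite sameR.
  have evb : eval w S st' (Reg 5) = Some b by apply: eval_reg; rewrite sameR.
  have evA' : eval w S st' (Reg 6) = Some A' by apply: eval_reg; rewrite sameR.
  have evb' : eval w S st' (Reg 7) = Some b' by apply: eval_reg; rewrite sameR.
  have kw : k < 2 ^ w by lia.
  have /andP[slot_gt slot_lt] := dst_slot k.
  have evS := eval_slot S_le evA' evb' evk slot_lt kw w0.
  exists 1.
    have := @eval_ltn w S st' (Reg 8) (Read (Cst 0)) k (w %/ 2).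
    rewrite kB; apply=> //; apply: eval_read (eval_cst _ _ _) _ _; [lia|lia|].
    by rewrite sameM.
  split=> //.
  set W := cells st' (slot A' b' k); set off := shift b' k.
  set f := counter (cells st) A b k.
  (* The part of the old contents that is kept: nothing on the first visit, at [k < b'], and
     everything later. *)
  pose X := ((k < b' : nat) == 0) * W.
  have fb : f < 2 ^ b'.
    by apply: leq_trans (counter_lt _ _ _ _) _; rewrite leq_exp2l.
  have X_lt : X < 2 ^ off.
    rewrite /X; case: (ltnP k b') => [_|le]; first by rewrite /= mul0n expn_gt0.
    by rewrite /= mul1n fresh // (leq_trans _ le) // ltn_mod.
  have fits : off + b' <= w by apply: shift_fits => //; apply: ltnW.
  (* The value written occupies only bits below [off + b']; this serves both as word bound and as
     zero condition for later counters of the cell. *)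
  have V_lt e : off + b' <= e -> X + f * 2 ^ off < 2 ^ e.
    move=> le; apply: leq_trans (leq_pexp2l _ le) => //.
    rewrite expnD; apply: (@leq_trans (2 ^ off + f * 2 ^ off)); first by rewrite ltn_add2r.
    by rewrite -mulSn mulnC leq_mul2l fb orbT.
  (* An earlier counter in the same cell means that this is not the first visit, so its bits are
     kept. *)
  have XW i : i < k -> i %% b' = k %% b' -> X = W.
    rewrite /X; case: (ltnP k b') => [lt ik|]; last by rewrite /= mul1n.
    by rewrite !modn_small ?(ltn_trans ik lt) // => e; rewrite e ltnn in ik.
  have Vw := V_lt w fits.
  apply: runs_seq; apply: (runs_write (a := slot A' b' k) (b := X + f * 2 ^ off)) => //.
    apply: eval_add => //.
      apply: eval_mul; last by apply: leq_ltn_trans Vw; apply: leq_addr.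
        by apply: eval_eqn (eval_cst _ _ _); [apply: eval_ltn | lia].
      exact: eval_read evS _ _.
    apply: eval_shl; last by apply: leq_ltn_trans Vw; apply: leq_addl.
      rewrite /f -(source_unchanged k sameM).
      by apply: eval_counter => //; [apply: src_lt | apply: leq_ltn_trans b'_lt].
    exact: eval_shift.
  apply: runs_assign.
    by apply: (eval_add (a := k) (b := 1)); rewrite ?eval_cst //= ?kR //; lia.
  split=> /=.
  - by move=> r r8; rewrite update_neq // sameR.
  - by rewrite update_eq addn1.
  - move=> a le; rewrite update_neq ?sameM //; apply/eqP => e; lia.
  - move=> i; rewrite ltnS leq_eqVlt => /orP[/eqP->|ik].
      rewrite /counter update_eq; split=> //; exact: field_top.
    have [e|ne] := eqVneq (slot A' b' i) (slot A' b' k).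
      have e' : i %% b' = k %% b' by move: e; rewrite /slot => /addnI.
      have [<- _] := done i ik; rewrite /counter e update_eq; split=> //.
      by rewrite (XW i ik e') field_add_above //; apply: shift_sep.
    by rewrite /counter update_neq //; apply: done.
  - move=> i ki; rewrite ltnS leq_eqVlt => ci.
    have [e|ne] := eqVneq (slot A' b' i) (slot A' b' k).
      have e' : k %% b' = i %% b' by move: e; rewrite /slot => /addnI.
      by rewrite e update_eq; apply: V_lt; apply: shift_sep.
    rewrite update_neq //; apply: fresh; first exact: ltnW.
    case/orP: ci => // /eqP ci; case/eqP: ne; rewrite /slot ci.
    by rewrite (modn_small (m := k)) // -ci ltn_mod.
Unshelve. rewrite /=; lia.
Qed.

End CopyLoop.

(** * Degrees *)

Section Degrees.

Variable n : nat.
Implicit Types (F : {set {set 'I_n}}) (u v : 'I_n).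

Definition all_pairs F : Prop := forall e, e \in F -> #|e| = 2.

Lemma degree_sum F v : degree F v = \sum_(e in F) (v \in e).
Proof. by rewrite /degree -sum1dep_card big_mkcondr. Qed.

Lemma degree0 v : degree set0 v = 0.
Proof. by rewrite degree_sum big_set0. Qed.

Lemma degree_setU1 F e v : e \notin F -> degree (e |: F) v = (v \in e) + degree F v.
Proof. by move=> eF; rewrite !degree_sum big_setU1. Qed.

(** An edge at [v] is [[set v; u]] for one of the [n - 1] vertices [u] other than [v]. *)
Lemma degree_lt F v : all_pairs F -> degree F v < n.
Proof.
move=> F2; apply: (@leq_ltn_trans #|[set [set v; u] | u in [set~ v]]|); last first.
  apply: leq_ltn_trans (leq_imset_card _ _) _.
  by rewrite cardsC1 card_ord; case: (n) v => [[]|].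
apply: subset_leq_card; apply/subsetP => e; rewrite inE => /andP[eF ve].
have /eqP := F2 e eF; rewrite (cardsD1 v) ve add1n eqSS => /cards1P[u eu].
have ue : u \in e :\ v by rewrite eu set11.
apply/imsetP; exists u; first by move: ue; rewrite !inE => /andP[].
by rewrite -eu setD1K.
Qed.

Lemma handshake F : all_pairs F -> \sum_v degree F v = 2 * #|F|.
Proof.
move=> F2; under eq_bigr => v _ do rewrite degree_sum.
rewrite exchange_big /= mulnC -sum_nat_const; apply: eq_bigr => e eF.
by rewrite -(F2 e eF) -sum1_card [RHS]big_mkcond.
Qed.

End Degrees.

Lemma runs_call w S c args M T (P : state -> Prop) :
  runs w S c (State (nth 0 args) M) T P ->
  exists t M' r, [/\ call w S c args M t M' r, t <= T
                   & exists rs, P (State rs M') /\ rs 0 = r].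
Proof.
move=> [t [[rs M'] [E le_t Ps]]]; exists t, M', (rs 0); split=> //; by exists rs.
Qed.

Lemma sum_divn_le (I : finType) (F : I -> nat) q :
  0 < q -> \sum_i F i %/ q <= (\sum_i F i) %/ q.
Proof.
move=> q0; rewrite leq_divRL // big_distrl /=; apply: leq_sum => i _.
exact: leq_divM.
Qed.

Lemma slot_bound A b i : 0 < b -> A < slot A b i <= A + b.
Proof. by rewrite /slot => bp; have := ltn_pmod i bp; move: (i %% b) => r; lia. Qed.

(** * The dynamic structure: invariant, space and amortized time *)

Section Dynamic.

Variables w S n b0 nb Tot s : nat.
Let B := w %/ 2.

Definition width (g : nat) : nat := if g is g'.+1 then b0 * 2 ^ g' else 0.

(** All cells ever allocated to a block moved [g] times, abandoned copies included; each copy has a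
    header cell. *)
Fixpoint heap (g : nat) : nat := if g is g'.+1 then heap g' + (width g).+1 else 0.

Definition block_sum (d : nat -> nat) (j : nat) : nat := \sum_(i < B) d (j * B + i).

(* [gam j] is the number of times that block [j] has been moved. *)
Record represents (gam d : nat -> nat) (M : memory) : Prop := Represents {
  rep_block : M 0 = B;
  rep_b0 : M 1 = b0;
  rep_null : M 3 = 0;
  rep_top : M 2 = 4 + nb + \sum_(j < nb) heap (gam j);
  rep_ptr0 : forall j, j < nb -> gam j = 0 -> M (j + 4) = 3;
  rep_ptr : forall j, j < nb -> 0 < gam j ->
    4 + nb <= M (j + 4) /\ M (j + 4) + width (gam j) < M 2;
  rep_disj : forall j j', j < nb -> j' < nb -> j != j' -> 0 < gam j -> 0 < gam j' ->
    M (j + 4) + width (gam j) < M (j' + 4) \/ M (j' + 4) + width (gam j') < M (j + 4);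
  rep_head : forall j, j < nb -> M (M (j + 4)) = width (gam j);
  rep_word : forall j i, j < nb -> i < B -> 0 < gam j ->
    M (slot (M (j + 4)) (width (gam j)) i) < 2 ^ w;
  rep_counter : forall j i, j < nb -> i < B ->
    counter M (M (j + 4)) (width (gam j)) i = d (j * B + i);
  rep_width : forall j, j < nb -> width (gam j) < w }.

(** A block leaves a positive width [b] only when one of its counters reaches [2 ^ b], and degrees
    never decrease. The first move, from width 0, imposes no condition. *)
Definition grown (gam d : nat -> nat) : Prop :=
  forall j g, j < nb -> gam j = g.+2 -> 2 ^ width g.+1 <= block_sum d j.

Hypothesis w_ge : 32 <= w.
Hypothesis n_le : n ^ 2 <= 2 ^ w.
Hypothesis b0_gt0 : 0 < b0.
Hypothesis b0_lt : b0 < w.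
Hypothesis B_le : B <= 2 ^ b0.
Hypothesis nbE : nb = (n %/ B).+1.
Hypothesis S_le : S <= 2 ^ w.
Hypothesis S_ge : 4 + nb + B + 3 * (nb * (b0 + 2 * s) + 2 * (Tot %/ 2 ^ s)) <= S.

Lemma width_gt0 g : 0 < g -> 0 < width g.
Proof. by case: g => // g _; rewrite muln_gt0 b0_gt0 expn_gt0. Qed.

(** The widths form a geometric series below twice the last one; the [g] headers add at most one
    more width, because [h < 2 ^ h]. *)
Lemma heap_le g : heap g <= 3 * width g.
Proof.
case: g => // g; suff: heap g.+1 + b0 <= 2 * width g.+1 + g.+1.
  have : g < 2 ^ g by apply: ltn_expl.
  rewrite /width => lt; have := leq_mul b0_gt0 lt; rewrite mul1n; lia.
elim: g => [|g IH]; first by rewrite /= expn0; lia.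
have -> : heap g.+2 = heap g.+1 + (width g.+2).+1 by [].
have -> : width g.+2 = 2 * width g.+1 by rewrite /= expnS mulnCA.
by lia.
Qed.

(** [s] is a free threshold. Let [b] be the width before the last doubling: either [b <= s], or
    [b - s < 2 ^ (b - s)], which is at most the degree sum divided by [2 ^ s]. *)
Lemma width_le g d j :
  (forall h, g = h.+2 -> 2 ^ width h.+1 <= block_sum d j) ->
  width g <= b0 + 2 * s + 2 * (block_sum d j %/ 2 ^ s).
Proof.
case: g => [|[|g]] H //; first by rewrite /= expn0 muln1 -addnA leq_addr.
have {H} := H g erefl; rewrite /width expnS mulnCA; set b := b0 * _ => le.
have [|lt] := leqP b s; first by move: (_ %/ _) => X; lia.
have : 2 ^ (b - s) <= block_sum d j %/ 2 ^ s.
  by rewrite leq_divRL ?expn_gt0 // -expnD subnK // ltnW.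
by move: (_ %/ _) (ltn_expl (b - s) (isT : 1 < 2)) => X; lia.
Qed.

Lemma heap_fits (gam d : nat -> nat) :
  grown gam d -> \sum_(j < nb) block_sum d j <= Tot ->
  4 + nb + B + \sum_(j < nb) heap (gam j) <= S.
Proof.
move=> H leT; apply: leq_trans S_ge; rewrite leq_add2l.
apply: (@leq_trans (\sum_(j < nb) 3 * (b0 + 2 * s + 2 * (block_sum d j %/ 2 ^ s)))).
  apply: leq_sum => j _; apply: (leq_trans (heap_le _)); rewrite leq_mul2l /=.
  by apply: width_le => h; apply: H.
rewrite -big_distrr leq_mul2l /= big_split /= sum_nat_const card_ord leq_add2l.
rewrite -big_distrr leq_mul2l /=; apply: leq_trans (leq_div2r _ leT).
by apply: sum_divn_le; rewrite expn_gt0.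
Qed.

(** The amortization of the [O(B)] time per move. The first move of a block is charged to the block;
    [g.+1] further ones cost [B * g.+1 <= 2 ^ b0 * 2 ^ g <= 2 ^ width g.+1], which the degree sum
    dominates. *)
Lemma grows_cost (gam d : nat -> nat) :
  grown gam d -> B * \sum_(j < nb) gam j <= B * nb + \sum_(j < nb) block_sum d j.
Proof.
move=> H; have -> : B * nb = \sum_(j < nb) B by rewrite sum_nat_const card_ord mulnC.
rewrite big_distrr -big_split /=.
apply: leq_sum => j _; case E: (gam j) => [|[|g]]; rewrite ?muln0 ?muln1 ?leq_addr //.
rewrite mulnS leq_add2l; apply: leq_trans (H j g (ltn_ord j) E).
apply: (@leq_trans (2 ^ (b0 + g))).
  by rewrite expnD leq_mul // ltn_expl.
rewrite leq_exp2l //= ; elim: (g) => [|h IH]; first by rewrite expn0; lia.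
by rewrite expnS; have := expn_gt0 2 h; nia.
Qed.


Lemma B_gt0 : 0 < B.
Proof. by rewrite /B; lia. Qed.

Lemma vertex_ltn v : v < n -> v %/ B < nb.
Proof. by move=> vn; rewrite nbE ltnS leq_div2r // ltnW. Qed.

Lemma vertex_inj j i j' i' :
  i < B -> i' < B -> j * B + i = j' * B + i' -> j = j' /\ i = i'.
Proof.
move=> iB i'B e; have := congr1 (divn^~ B) e; have := congr1 (modn^~ B) e.
by rewrite !modnMDl !divnMDl ?B_gt0 // !modn_small // !divn_small // !addn0.
Qed.

Lemma block_in gam d M j : represents gam d M -> j < nb -> M (j + 4) < M 2.
Proof.
move=> rep jn; have [g0|g0] := posnP (gam j); last by case: (rep_ptr rep jn g0); lia.
by rewrite (rep_ptr0 rep) // (rep_top rep); lia.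
Qed.

(** For the shared block of width 0 the slot is [4 + i], since [i %% 0 = i]; this is where the spare
    [B] cells are required. *)
Lemma slot_in gam d M j i :
  represents gam d M -> 4 + nb + B <= S -> M 2 <= S -> j < nb -> i < B ->
  slot (M (j + 4)) (width (gam j)) i < S.
Proof.
move=> rep S1 S2 jn iB; have [g0|g0] := posnP (gam j).
  by rewrite g0 (rep_ptr0 rep) // /slot /width modn0; lia.
have [_ lt] := rep_ptr rep jn g0.
by have := slot_bound (M (j + 4)) i (width_gt0 g0); lia.
Qed.

(** The new copy starts at the first free address, above every block in use; below it only directory
    entry [j] and cell 2 change. *)
Lemma represents_grow gam d M M1 j (b' := width (gam j).+1) :
  represents gam d M -> j < nb -> b' < w ->
  (forall a, a < M 2 -> M1 a = M a) -> M1 (M 2) = b' ->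
  (forall i, i < B -> counter M1 (M 2) b' i = d (j * B + i) /\
                      M1 (slot (M 2) b' i) < 2 ^ w) ->
  represents (update gam j (gam j).+1) d
    (update (update M1 (j + 4) (M 2)) 2 (M 2 + 1 + b')).
Proof.
move=> rep jn b'w same head new.
have top_ge : 4 + nb <= M 2 by rewrite (rep_top rep) leq_addr.
set M' := update _ 2 _.
have M'2 : M' 2 = M 2 + 1 + b' by rewrite /M' update_eq.
have M'low a : a < M 2 -> a != 2 -> a != j + 4 -> M' a = M a.
  by move=> lt a2 aj; rewrite /M' !update_neq // same.
have M'high a : M 2 <= a -> M' a = M1 a.
  by move=> le; rewrite /M' !update_neq //; apply/eqP; lia.
have M'j : M' (j + 4) = M 2.
  by rewrite /M' update_neq ?update_eq //; apply/eqP; lia.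
have M'ptr j' : j' < nb -> j' != j -> M' (j' + 4) = M (j' + 4).
  by move=> lt ne; rewrite M'low //; lia.
have M'blk j' a : j' < nb -> 0 < gam j' -> M (j' + 4) <= a <= M (j' + 4) + width (gam j') ->
    M' a = M a.
  by move=> lt g0 le; have [? ?] := rep_ptr rep lt g0; apply: M'low; lia.
have slotb j' i : 0 < gam j' ->
    M (j' + 4) <= slot (M (j' + 4)) (width (gam j')) i <= M (j' + 4) + width (gam j').
  by move=> g0; have := slot_bound (M (j' + 4)) i (width_gt0 g0); lia.
have b'0 : 0 < b' by apply: width_gt0.
split.
- by rewrite M'low ?(rep_block rep) //; lia.
- by rewrite M'low ?(rep_b0 rep) //; lia.
- by rewrite M'low ?(rep_null rep) //; lia.
- rewrite M'2 (rep_top rep) (bigD1 (Ordinal jn)) // [in RHS](bigD1 (Ordinal jn)) //=.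
  rewrite update_eq [heap _.+1]/= -/b'.
  under [in RHS]eq_bigr => i ne do rewrite update_neq //.
  by rewrite /b' /width; lia.
- move=> j' lt; have [->|ne] := eqVneq j' j; first by rewrite update_eq.
  by rewrite update_neq // M'ptr //; exact: (rep_ptr0 rep lt).
- move=> j' lt; have [->|ne] := eqVneq j' j.
    by rewrite update_eq M'j M'2 -/b' => _; lia.
  by rewrite update_neq // M'ptr // M'2 => /(rep_ptr rep lt); lia.
- move=> j1 j2 lt1 lt2; have [->|ne1] := eqVneq j1 j; have [->|ne2] := eqVneq j2 j.
  + by rewrite ?eqxx.
  + rewrite update_eq update_neq // M'j M'ptr // => _ _ /(rep_ptr rep lt2); lia.
  + rewrite update_eq update_neq // M'j M'ptr // => _ /(rep_ptr rep lt1); lia.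
  by rewrite !update_neq // !M'ptr // => ne; exact: (rep_disj rep).
- move=> j' lt; have [->|ne] := eqVneq j' j; first by rewrite update_eq M'j M'high.
  rewrite update_neq // M'ptr // -(rep_head rep lt).
  have [g0|g0] := posnP (gam j'); last by apply: M'blk lt g0 _; rewrite leqnn leq_addr.
  by rewrite (rep_ptr0 rep) // M'low //; lia.
- move=> j' i lt iB; have [->|ne] := eqVneq j' j.
    rewrite update_eq M'j M'high; first by case: (new i iB).
    by have := slot_bound (M 2) i b'0; rewrite -/b'; lia.
  rewrite update_neq // M'ptr // => g0; rewrite (M'blk j') ?slotb //.
  exact: (rep_word rep).
- move=> j' i lt iB; have [->|ne] := eqVneq j' j.
    rewrite update_eq M'j; case: (new i iB) => <- _.
    by rewrite /counter M'high //; have := slot_bound (M 2) i b'0; rewrite -/b'; lia.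
  rewrite update_neq // M'ptr // -(rep_counter rep lt iB).
  have [g0|g0] := posnP (gam j'); first by rewrite g0 !counter_width0.
  by rewrite /counter (M'blk j') ?slotb.
- move=> j' lt; have [->|ne] := eqVneq j' j; first by rewrite update_eq.
  by rewrite update_neq //; apply: rep_width rep _ _.
Qed.

(** Any other vertex is in a disjoint block, in another cell of the same block, or in another field
    of the same cell, which the carry-free increment leaves alone. *)
Lemma represents_bump gam d M j i (b := width (gam j)) (a := slot (M (j + 4)) b i) :
  represents gam d M -> j < nb -> i < B -> (d (j * B + i)).+1 < 2 ^ b ->
  represents gam (update d (j * B + i) (d (j * B + i)).+1)
    (update M a (M a + 2 ^ shift b i)).
Proof.
move=> rep jn iB lt; have cE := rep_counter rep jn iB.
(* Width 0 is excluded, as a successor cannot be below [2 ^ 0]. *)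
have g0 : 0 < gam j by rewrite lt0n; apply: contraTneq lt => g0; rewrite /b g0.
have b_gt0 : 0 < b by apply: width_gt0.
have [ptr_ge ptr_lt] := rep_ptr rep jn g0.
have a_b := slot_bound (M (j + 4)) i b_gt0; rewrite -/a in a_b.
set M' := update M _ _.
have M'low x : x < M 2 -> (x <= M (j + 4)) || (M (j + 4) + b < x) -> M' x = M x.
  by move=> lt2 ne; rewrite /M' update_neq //; apply/eqP => e; lia.
have M'ptr j' : j' < nb -> M' (j' + 4) = M (j' + 4).
  by move=> jn'; rewrite M'low //; lia.
have M'2 : M' 2 = M 2 by rewrite /M' update_neq //; lia.
have M'other j' x : j' < nb -> j' != j -> 0 < gam j' ->
    M (j' + 4) <= x <= M (j' + 4) + width (gam j') -> M' x = M x.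
  move=> jn' ne g0' le; rewrite /M' update_neq //; apply/eqP => e.
  by case: (rep_disj rep jn' jn ne g0' g0); rewrite -/b; lia.
have slotb j' i' : 0 < gam j' ->
    M (j' + 4) <= slot (M (j' + 4)) (width (gam j')) i' <= M (j' + 4) + width (gam j').
  by move=> g0'; have := slot_bound (M (j' + 4)) i' (width_gt0 g0'); lia.
have fits : shift b i + b <= w by apply: shift_fits => //; apply/ltnW/(rep_width rep).
have lt' : (field (M a) (shift b i) b).+1 < 2 ^ b by rewrite [field _ _ _]cE.
split.
- by rewrite M'low ?(rep_block rep) //; lia.
- by rewrite M'low ?(rep_b0 rep) //; lia.
- by rewrite M'low ?(rep_null rep) //; lia.
- by rewrite M'2; exact: (rep_top rep).
- by move=> j' jn' g0'; rewrite M'ptr //; exact: (rep_ptr0 rep).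
- by move=> j' jn' g0'; rewrite M'ptr // M'2; exact: (rep_ptr rep).
- by move=> j1 j2 jn1 jn2; rewrite !M'ptr //; exact: (rep_disj rep).
- move=> j' jn'; rewrite M'ptr // -(rep_head rep jn').
  have [g0'|g0'] := posnP (gam j').
    by rewrite (rep_ptr0 rep) // M'low //; lia.
  have [->|ne] := eqVneq j' j; first by rewrite M'low //; lia.
  by apply: M'other jn' ne g0' _; rewrite leqnn leq_addr.
- move=> j' i' jn' iB' g0'; rewrite M'ptr //.
  have := rep_word rep jn' iB' g0'.
  have [->|ne] := eqVneq j' j; last by rewrite (M'other j') ?slotb.
  rewrite -/b; have [->|ne] := eqVneq (slot (M (j + 4)) b i') a; last by rewrite /M' update_neq.
  by rewrite /M' update_eq; exact: incr_lt_pow lt' fits.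
- move=> j' i' jn' iB'; rewrite M'ptr //.
  have [e|ne] := eqVneq (j' * B + i') (j * B + i).
    have [-> ->] := vertex_inj iB' iB e.
    by rewrite update_eq /counter -/b -/a /M' update_eq field_incr // [field _ _ _]cE.
  rewrite update_neq // -(rep_counter rep jn' iB').
  have [g0'|g0'] := posnP (gam j'); first by rewrite g0' !counter_width0.
  have [ej|nej] := eqVneq j' j; last by rewrite /counter (M'other j') ?slotb.
  rewrite ej -/b /counter; have [es|nes] := eqVneq (slot (M (j + 4)) b i') a; last first.
    by rewrite /M' update_neq.
  rewrite es /M' update_eq; apply: field_incr_other => //.
  have em : i' %% b = i %% b by move: es; rewrite /a /slot => /addnI.
  have [lti|gti|ei] := ltngtP i' i; last by rewrite ej ei eqxx in ne.
    by right; apply: shift_sep.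
  by left; apply: shift_sep.
- exact: (rep_width rep).
Qed.

Lemma room : 4 + nb + B <= S.
Proof. exact: leq_trans (leq_addr _ _) S_ge. Qed.

Definition located gam (M : memory) v st :=
  [/\ regs st 2 = v %/ B, regs st 3 = v %% B, regs st 4 = M (v %/ B + 4)
    & regs st 5 = width (gam (v %/ B))].

Lemma locate_runs gam d st v :
  represents gam d (cells st) -> cells st 2 <= S -> regs st 0 = v -> v < n ->
  runs w S locate st 40 (fun st' =>
    [/\ cells st' = cells st, regs st' 1 = regs st 1 & located gam (cells st) v st']).
Proof.
move=> rep topS v_reg vn; have wlt : w < 2 ^ w by apply: ltn_expl.
have Sr := room.
have jn := vertex_ltn vn.
have evB st' : cells st' = cells st -> eval w S st' (Read (Cst 0)) = Some B.
  move=> eM; apply: eval_read (eval_cst _ _ _) _ _; [lia|lia|].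
  by rewrite eM (rep_block rep).
(* The time accumulates along the program and is compared with the bound only at the end; later
   proofs do the same. *)
apply: (@runs_weaken w S _ _ _ _ _ _); [|shelve|by move=> st' H; exact: H].
apply: runs_seq; apply: (runs_assign (a := v %/ B)).
  by apply: eval_div (evB _ _) => //; apply: eval_reg.
apply: runs_seq; apply: (runs_assign (a := v %% B)).
  by apply: eval_mod (evB _ _) => //; apply: eval_reg; rewrite /= update_neq.
apply: runs_seq; apply: runs_assign.
  apply: (eval_read (a := v %/ B + 4)); [|by move: (v %/ B) jn => j; lia|by []].
  apply: (eval_add (a := v %/ B) (b := 4)) => //.
    by apply: eval_cst; lia.
  by move: (v %/ B) jn => j; lia.
apply: runs_assign.
  apply: (eval_read (a := cells st (v %/ B + 4))) => //=.
  exact: leq_trans (block_in rep jn) topS.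
by split=> //; split=> //=; rewrite !update_eq (rep_head rep).
Unshelve. by [].
Qed.

Lemma query_runs gam d st v :
  represents gam d (cells st) -> cells st 2 <= S -> regs st 0 = v -> v < n ->
  runs w S (dd_degree degrees) st 100 (fun st' => cells st' = cells st /\ regs st' 0 = d v).
Proof.
move=> rep topS v_reg vn; have wlt : w < 2 ^ w by apply: ltn_expl.
have Sr := room.
have jn := vertex_ltn vn.
have iB : v %% B < B by rewrite ltn_mod B_gt0.
have Bw : B <= w by apply: leq_div.
apply: (@runs_weaken w S _ _ _ _ _ _); [|shelve|by move=> st' H; exact: H].
apply: runs_seq; apply: runs_weaken (locate_runs rep topS v_reg vn) (leqnn _) _.
move=> st' [eM _ [r2 r3 r4 r5]]; apply: runs_assign.
  apply: (eval_counter (A := cells st (v %/ B + 4)) (b := width (gam (v %/ B)))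
            (i := v %% B)) => //.
  - by rewrite /= r4.
  - by rewrite /= r5.
  - by rewrite /= r3.
  - exact: slot_in rep Sr topS jn iB.
  - by lia.
  - by lia.
  exact: (rep_width rep).
rewrite /= eM update_eq (rep_counter rep) //.
by rewrite -divn_eq.
Unshelve. by [].
Qed.

Lemma bump_runs gam d st v :
  represents gam d (cells st) -> cells st 2 <= S -> v < n ->
  located gam (cells st) v st -> (d v).+1 < 2 ^ width (gam (v %/ B)) ->
  runs w S bump st 60 (fun st' =>
    [/\ regs st' = regs st, cells st' 2 = cells st 2
      & represents gam (update d v (d v).+1) (cells st')]).
Proof.
move=> rep topS vn [r2 r3 r4 r5] lt; have wlt : w < 2 ^ w by apply: ltn_expl.
have Sr := room.
have jn := vertex_ltn vn.
have iB : v %% B < B by rewrite ltn_mod B_gt0.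
have Bw : B <= w by apply: leq_div.
have ev4 : eval w S st (Reg 4) = Some (cells st (v %/ B + 4)) by apply: eval_reg.
have ev5 : eval w S st (Reg 5) = Some (width (gam (v %/ B))) by apply: eval_reg.
have ev3 : eval w S st (Reg 3) = Some (v %% B) by apply: eval_reg.
have slotS := slot_in rep Sr topS jn iB.
have w0 : 0 < w by lia.
have iw : v %% B < 2 ^ w by lia.
have evs := eval_slot S_le ev4 ev5 ev3 slotS iw w0.
have vE := divn_eq v B.
have g0 : 0 < gam (v %/ B) by rewrite lt0n; apply: contraTneq lt => ->.
have fits : shift (width (gam (v %/ B))) (v %% B) + width (gam (v %/ B)) <= w.
  by apply: shift_fits => //; apply/ltnW/(rep_width rep).
have := rep_counter rep jn iB; rewrite -vE => cE.
apply: (@runs_weaken w S _ _ _ _ _ _); [|shelve|by move=> st' H; exact: H].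
apply: (runs_write evs _ slotS).
  apply: eval_add; first exact: eval_read evs slotS _.
    apply: (eval_shl (a := 1)); first by apply: eval_cst; lia.
      exact: (eval_shift (b := width (gam (v %/ B))) (i := v %% B)).
    by rewrite mul1n ltn_exp2l //; have := width_gt0 g0; lia.
  rewrite mul1n; apply: (incr_lt_pow (b := width (gam (v %/ B)))) => //.
    by rewrite [field _ _ _]cE.
  exact: (rep_word rep).
split=> //.
  rewrite /= update_neq //; have [lt4 _] := rep_ptr rep jn g0.
  by have := slot_bound (cells st (v %/ B + 4)) (v %% B) (width_gt0 g0); lia.
rewrite /= mul1n; have := represents_bump rep jn iB; rewrite -vE; exact.
Unshelve. by [].
Qed.

Lemma grow_runs gam d st v :
  represents gam d (cells st) -> v < n ->
  located gam (cells st) v st -> let j := v %/ B in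
  width (gam j).+1 < w -> cells st 2 + 1 + width (gam j).+1 < S ->
  runs w S grow st (B * 60 + 160) (fun st' =>
    [/\ regs st' 1 = regs st 1, located (update gam j (gam j).+1) (cells st') v st'
      & represents (update gam j (gam j).+1) d (cells st')]).
Proof.
move=> rep vn [r2 r3 r4 r5] j; set b' := width (gam j).+1 => b'w topS.
have wlt : w < 2 ^ w by apply: ltn_expl.
have Sr := room.
have jn : j < nb := vertex_ltn vn.
have Bw : B <= w by apply: leq_div.
have top_ge : 4 + nb <= cells st 2 by rewrite (rep_top rep) leq_addr.
have b_le : width (gam j) <= b'.
  rewrite /b' /width; case: (gam j) => // g.
  by rewrite leq_mul2l leq_exp2l // leqnSn orbT.
(* The branch-free formula of [grow]: doubling from a positive width, [b0] from width 0. *)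
have b'E : width (gam j) + width (gam j) + b0 * (width (gam j) == 0) = b'.
  rewrite /b' /width; case: (gam j) => [|g]; first by rewrite expn0.
  by rewrite muln_eq0 expn_eq0 -(negbK (b0 == 0)) -lt0n b0_gt0 /= muln0 addn0 expnS; lia.
set A := cells st (j + 4) in r4; set b := width (gam j) in r5 b_le b'E.
have bb : b + b < w by apply: leq_ltn_trans b'w; rewrite -b'E leq_addr.
apply: (@runs_weaken w S _ _ _ _ _ _); [|shelve|by move=> st' H; exact: H].
apply: runs_seq; apply: runs_assign.
  by apply: (eval_read (a := 2)); [apply: eval_cst; lia | lia | by []].
apply: runs_seq; apply: (runs_assign (a := b')).
  rewrite -b'E; apply: eval_add; last by rewrite b'E; lia.
    by apply: (eval_add (a := b) (b := b)); rewrite /= ?update_neq ?r5 //; apply: ltn_trans wlt.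
  apply: (eval_mul (a := b0) (b := b == 0)); last by case: (b == 0); lia.
    apply: (eval_read (a := 1)); [apply: eval_cst; lia | lia | exact: (rep_b0 rep)].
  by apply: (eval_eqn (a := b) (b := 0)); [rewrite /= update_neq // r5 | apply: eval_cst; lia].
apply: runs_seq; apply: (runs_write (a := cells st 2) (b := b')) => //=; first by lia.
apply: runs_seq; apply: (runs_assign (a := 0)); first by apply: eval_cst; lia.
set st1 := State _ _.
have low a : a < cells st 2 -> cells st1 a = cells st a.
  by move=> lt; rewrite /= update_neq //; apply/eqP; lia.
(* The new header is written at the first free address, outside the old copy. *)
have cE i : counter (cells st1) A b i = counter (cells st) A b i.
  have [b_eq0|b_gt0] := posnP b; first by rewrite b_eq0 !counter_width0.
  have g0 : 0 < gam j by rewrite lt0n; apply: contraTneq b_gt0 => g0; rewrite /b g0.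
  have [_ lt2] := rep_ptr rep jn g0.
  by rewrite /counter low //; have := slot_bound A i b_gt0; rewrite /A /b in lt2 *; lia.
apply: runs_seq; apply: runs_weaken.
- apply: (@copy_loop_runs w S st1 A b (cells st 2) b') => //=.
  + by rewrite update_neq ?(rep_block rep) //; apply/eqP; lia.
  + exact: width_gt0.
  + move=> i iB; apply: slot_in rep Sr _ jn iB; lia.
  + move=> b_gt0 i; have g0 : 0 < gam j.
      by rewrite lt0n; apply: contraTneq b_gt0 => g0; rewrite /b g0.
    have [_ lt2] := rep_ptr rep jn g0.
    by have := slot_bound A i b_gt0; rewrite /A /b in lt2 *; lia.
  + by lia.
- exact: leqnn.
move=> st2 [sameR sameM new].
have R6 : regs st2 6 = cells st 2 by rewrite sameR.
have R7 : regs st2 7 = b' by rewrite sameR.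
have R2 : regs st2 2 = j by rewrite sameR.
apply: runs_seq; apply: (runs_write (a := j + 4) (b := cells st 2)).
- apply: eval_add; first by apply: eval_reg.
    by apply: eval_cst; lia.
  by lia.
- exact: eval_reg.
- by lia.
apply: runs_seq; apply: (runs_write (a := 2) (b := cells st 2 + 1 + b')).
- by apply: eval_cst; lia.
- apply: (eval_add (a := cells st 2 + 1)); last by lia.
    apply: (eval_add (a := cells st 2) (b := 1)); [exact: eval_reg R6| |by lia].
    by apply: eval_cst; lia.
  exact: eval_reg R7.
- by lia.
apply: runs_seq; apply: (runs_assign (a := cells st 2)); first exact: eval_reg R6.
apply: (runs_assign (a := b')); first exact: eval_reg R7.
have rep' := @represents_grow gam d (cells st) (cells st2) j rep jn b'w.
split=> //=.
- by rewrite !update_neq // sameR.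
- have jE : update (update (cells st2) (j + 4) (cells st 2)) 2 (cells st 2 + 1 + b') (j + 4)
      = cells st 2 by rewrite update_neq ?update_eq //; lia.
  split; rewrite -/j ?jE /=.
  + by rewrite !update_neq.
  + by rewrite !update_neq // sameR.
  + by rewrite update_neq // update_eq.
  + by rewrite !update_eq.
apply: rep'.
- by move=> a lt; rewrite sameM ?low // ltnW.
- by rewrite sameM //= update_eq.
- move=> i iB; have [-> ->] := new i iB; split=> //.
  by rewrite cE; apply: (rep_counter rep).
Unshelve. by rewrite /= /B; move: (w %/ 2) => x; lia.
Qed.

Lemma block_sum_incr d v j :
  block_sum (update d v (d v).+1) j = block_sum d j + (v %/ B == j).
Proof.
rewrite /block_sum; have iB : v %% B < B by rewrite ltn_mod B_gt0.
have [<-|ne] := eqVneq; last first.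
  rewrite addn0; apply: eq_bigr => i _; rewrite update_neq //.
  apply: contra ne => /eqP <-; rewrite divnMDl ?B_gt0 // divn_small //.
  by rewrite addn0.
rewrite (bigD1 (Ordinal iB)) //= [in RHS](bigD1 (Ordinal iB)) //= -divn_eq update_eq.
rewrite addn1 addSn; congr (_ + _).+1; apply: eq_bigr => i ne; rewrite update_neq //.
rewrite {2}(divn_eq v B) eqn_add2l; exact: ne.
Qed.

Lemma total_incr d v : v < n ->
  \sum_(j < nb) block_sum (update d v (d v).+1) j = (\sum_(j < nb) block_sum d j).+1.
Proof.
move=> vn; under eq_bigr => j _ do rewrite block_sum_incr.
rewrite big_split /= -addn1; congr (_ + _).
rewrite (bigD1 (Ordinal (vertex_ltn vn))) //= eqxx big1 // => j ne.
by apply/eqP; rewrite eqb0; apply: contra ne => /eqP e; apply/eqP/val_inj.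
Qed.

Lemma sum_update (F : nat -> nat) (gam : nat -> nat) j : j < nb ->
  \sum_(k < nb) F (update gam j (gam j).+1 k) + F (gam j)
    = \sum_(k < nb) F (gam k) + F (gam j).+1.
Proof.
move=> jn; rewrite !(bigD1 (Ordinal jn) (P := predT)) //= update_eq.
under eq_bigr => i ne do rewrite update_neq //.
by lia.
Qed.

Lemma top_le gam d M : represents gam d M -> grown gam d ->
  \sum_(j < nb) block_sum d j <= Tot -> M 2 <= S.
Proof.
by move=> rep gr tot; rewrite (rep_top rep); have := heap_fits gr tot; lia.
Qed.

(** An amortized bound: [60 * B] per move pays for the copy, so an increment costs at most 300
    beyond the growth of [60 * B] times the number of moves. *)
Lemma incr_runs gam d st v (d' := update d v (d v).+1) :
  represents gam d (cells st) -> grown gam d -> regs st 0 = v -> v < n ->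
  (d v).+1 < n -> \sum_(j < nb) block_sum d j < Tot ->
  exists gam' T,
  [/\ grown gam' d', T + 60 * (B * \sum_(j < nb) gam j)
                       <= 300 + 60 * (B * \sum_(j < nb) gam' j)
    & runs w S incr st T (fun st' =>
        regs st' 1 = regs st 1 /\ represents gam' d' (cells st'))].
Proof.
move=> rep gr v_reg vn dn tot; have wlt : w < 2 ^ w by apply: ltn_expl.
have topS := top_le rep gr (ltnW tot); have Sr := room.
have jn := vertex_ltn vn; set j := v %/ B in jn *.
have iB : v %% B < B by rewrite ltn_mod B_gt0.
have Bw : B <= w by apply: leq_div.
have nw : n <= 2 ^ w by apply: leq_trans n_le; rewrite -mulnn leq_pmulr //; lia.
have cE := rep_counter rep jn iB; rewrite -divn_eq in cE.
have dlt : d v < 2 ^ width (gam j) by rewrite -cE counter_lt.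
have gr' gam' : (forall k, k != j -> gam' k = gam k) ->
    (forall g, gam' j = g.+2 -> 2 ^ width g.+1 <= block_sum d' j) -> grown gam' d'.
  move=> other this k g kn; have [->|ne] := eqVneq k j; first exact: this.
  rewrite other // => gk; apply: leq_trans (gr k g kn gk) _.
  by rewrite /d' block_sum_incr leq_addr.
have evc st' : cells st' = cells st -> located gam (cells st) v st' ->
    eval w S st' (Bin Eqn (Bin Add (counter_expr (Reg 4) (Reg 5) (Reg 3)) (Cst 1))
                 (Bin Shl (Cst 1) (Reg 5))) = Some ((d v).+1 == 2 ^ width (gam j) : nat).
  move=> eM [r2 r3 r4 r5]; apply: eval_eqn; last first.
    rewrite -[2 ^ _]mul1n; apply: eval_shl; first by apply: eval_cst; lia.
      by rewrite /= r5.
    by rewrite mul1n ltn_exp2l //; apply: (rep_width rep).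
  rewrite -(addn1 (d v)); apply: eval_add; last by lia.
    rewrite -cE -eM; apply: eval_counter => //; rewrite /= ?r3 ?r4 ?r5 ?eM //.
    - exact: slot_in rep Sr topS jn iB.
    - by lia.
    - by lia.
    - exact: (rep_width rep).
  by apply: eval_cst; lia.
have [full|notfull] := eqVneq (d v).+1 (2 ^ width (gam j)); last first.
  exists gam; exists (40 + ((cost (Bin Eqn (Bin Add (counter_expr (Reg 4) (Reg 5) (Reg 3)) (Cst 1))
                 (Bin Shl (Cst 1) (Reg 5)))).+1 + 0 + 60)); split.
  - apply: gr' => // g gj; apply: leq_trans (gr j g jn gj) _.
    by rewrite /d' block_sum_incr leq_addr.
  - by rewrite leq_add2r.
  apply: runs_seq; apply: runs_weaken (locate_runs rep topS v_reg vn) (leqnn _) _.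
  move=> st1 [eM r1 loc]; apply: runs_seq; apply: runs_if (evc st1 eM loc) _.
  rewrite (negPf notfull); apply: runs_skip; rewrite -eM in rep topS loc.
  have lt : (d v).+1 < 2 ^ width (gam j) by rewrite ltn_neqAle notfull.
  apply: runs_weaken (bump_runs rep topS vn loc lt) (leqnn _) _.
  by move=> st2 [-> _ rep2]; split.
pose gam' := update gam j (gam j).+1.
(* Why a doubled width still fits in a word: a full counter is a degree, so [2 ^ b < n] and
   [2 ^ (b + b) < n ^ 2 <= 2 ^ w]. *)
have small b : 2 ^ b < n -> b + b < w.
  move=> lt; rewrite -(ltn_exp2l _ _ (isT : 1 < 2)); apply: leq_trans n_le.
  by rewrite expnD -mulnn ltn_mul.
have b'w : width (gam j).+1 < w.
  case g: (gam j) => [|h]; first by rewrite /= expn0 muln1.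
  rewrite full g in dn; have := small _ dn.
  by rewrite /width expnS mulnCA; lia.
have blt : width (gam j) < width (gam j).+1.
  case: (gam j) => [|h]; first by rewrite /= expn0 muln1.
  by rewrite /width ltn_pmul2l // ltn_exp2l.
have grg : grown gam' d'.
  apply: gr' => [k ne|g]; first by rewrite /gam' update_neq.
  rewrite /gam' update_eq => -[gj]; rewrite -gj -full.
  rewrite /block_sum (bigD1 (Ordinal iB)) //= -divn_eq /d' update_eq.
  exact: leq_addr.
(* The space bound is applied to the degrees after the increment, whose sum is still at most
   [Tot]. *)
have fit := heap_fits grg; rewrite /d' total_incr // in fit; have {fit} := fit tot.
have := sum_update heap gam jn; rewrite -/gam' => hs fit.
have topS' : cells st 2 + 1 + width (gam j).+1 < S.
  have hE : heap (gam j).+1 = heap (gam j) + (width (gam j).+1).+1 by [].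
  by rewrite (rep_top rep); have := B_gt0; lia.
exists gam'; exists (40 + ((cost (Bin Eqn (Bin Add (counter_expr (Reg 4) (Reg 5) (Reg 3)) (Cst 1))
                 (Bin Shl (Cst 1) (Reg 5)))).+1 + (B * 60 + 160) + 60)); split=> //.
  have -> : \sum_(k < nb) gam' k = (\sum_(k < nb) gam k).+1.
    by have := sum_update id gam jn; rewrite -/gam' /=; lia.
  by rewrite (mulnS B (\sum_(k < nb) gam k)) /=; move: (B * \sum_(k < nb) _) => x; lia.
apply: runs_seq; apply: runs_weaken (locate_runs rep topS v_reg vn) (leqnn _) _.
move=> st1 [eM r1 loc]; apply: runs_seq; apply: runs_if (evc st1 eM loc) _.
rewrite full eqxx; rewrite -eM in rep topS loc topS'.
apply: runs_weaken (grow_runs rep vn loc b'w topS') (leqnn _) _.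
move=> st2 [r1' loc' rep2].
have lt : (d v).+1 < 2 ^ width (gam' j).
  by rewrite full /gam' update_eq ltn_exp2l.
have top2 : cells st2 2 <= S.
  by rewrite (rep_top rep2) -/gam'; move: fit; rewrite -addnA; lia.
apply: runs_weaken (bump_runs rep2 top2 vn loc' lt) (leqnn _) _.
by move=> st3 [-> _ rep3]; split=> //; rewrite r1'.
Qed.

Lemma block_sum_total d k : \sum_(j < k) block_sum d j = \sum_(0 <= v < k * B) d v.
Proof.
elim: k => [|k IH]; first by rewrite big_ord0 mul0n big_geq.
rewrite big_ord_recr IH (@big_cat_nat _ _ _ (k * B) 0 (k.+1 * B)) ?leq_mul2r ?leqnSn ?orbT //=.
congr (_ + _); rewrite -[X in \big[_/_]_(X <= _ < _) _]add0n big_addn mulSn addnK big_mkord.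
by apply: eq_bigr => i _; rewrite addnC.
Qed.

Lemma total_degrees (d : nat -> nat) : (forall v, n <= v -> d v = 0) ->
  \sum_(j < nb) block_sum d j = \sum_(v < n) d v.
Proof.
move=> d0; rewrite block_sum_total.
have le : n <= nb * B by rewrite nbE; have := ltn_ceil n B_gt0; lia.
rewrite (@big_cat_nat _ _ _ n) //= big_mkord [X in _ + X]big_nat_cond [X in _ + X]big1 ?addn0 //.
by move=> v /andP[/andP[nv _] _]; apply: d0.
Qed.

Hypothesis w_le_b0 : w <= 2 ^ b0.
Hypothesis b0_min : forall b, b < b0 -> 2 ^ b < w.

Lemma init_runs M : runs w S degrees_init (State (nth 0 [:: n; w]) M)
  (20 * b0 + 30 * nb + 100) (fun st => represents (fun _ => 0) (fun _ => 0) (cells st)).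
Proof.
have wlt : w < 2 ^ w by apply: ltn_expl.
have Sr := room; have Bw : B <= w by apply: leq_div.
pose I1 k st := [/\ regs st 0 = n, regs st 1 = w & regs st 2 = k.+1].
pose I2 k st := [/\ regs st 3 = nb, regs st 4 = k,
  [/\ cells st 0 = B, cells st 1 = b0, cells st 2 = 4 + nb & cells st 3 = 0]
  & forall j, j < k -> cells st (j + 4) = 3].
apply: (@runs_weaken w S _ _ _ _ _ _); [|shelve|by move=> st' H; exact: H].
apply: runs_seq; apply: (runs_assign (a := 1)); first by apply: eval_cst; lia.
have evt st k : k < b0 -> I1 k st ->
    eval w S st (Bin Ltn (Bin Shl (Cst 1) (Reg 2)) (Reg 1)) = Some (2 ^ k.+1 < w : nat).
  move=> kb [_ r1 r2]; apply: eval_ltn; last exact: eval_reg.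
  rewrite -[2 ^ _]mul1n; apply: eval_shl; [by apply: eval_cst; lia|exact: eval_reg|].
  by rewrite mul1n ltn_exp2l //; lia.
(* The search starts from width 1, so [b0.-1] iterations reach [b0]. *)
apply: runs_seq; apply: (@runs_weaken w S _ _ _ _ (I1 b0.-1)); [|exact: leqnn|].
  apply: (runs_while (T := 4)) => //.
    move=> k st kb i1; have kb' : k.+1 < b0 by lia.
    exists 1; first by rewrite (evt st k) ?b0_min //; lia.
    split=> //; apply: (runs_assign (a := k.+2)).
      case: i1 => _ _ r2; rewrite -[k.+2]addn1.
      by apply: eval_add; [apply: eval_reg|apply: eval_cst; lia|lia].
    by case: i1 => r0 r1 r2; split.
  move=> st i1; rewrite (evt st b0.-1) //; last by lia.
  by rewrite prednK // ltnNge w_le_b0.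
move=> st1 [r0 r1 r2]; rewrite prednK // in r2.
apply: runs_seq; apply: (runs_write (a := 0) (b := B)); [by apply: eval_cst; lia| |lia|].
  by apply: eval_div; [apply: eval_reg | apply: eval_cst; lia].
apply: runs_seq; apply: (runs_write (a := 1) (b := b0)).
- by apply: eval_cst; lia.
- exact: eval_reg.
- by lia.
apply: runs_seq; apply: (runs_write (a := 3) (b := 0)); [by apply: eval_cst; lia| |lia|].
  by apply: eval_cst; lia.
apply: runs_seq; apply: (runs_assign (a := nb)).
  rewrite nbE -(addn1 (n %/ B)); apply: eval_add.
  2: by apply: eval_cst; lia.
  2: by rewrite addn1 -nbE; lia.
  apply: eval_div; first exact: eval_reg.
  by apply: (eval_read (a := 0)); [apply: eval_cst; lia|lia|].
apply: runs_seq; apply: (runs_write (a := 2) (b := 4 + nb)); [by apply: eval_cst; lia| |lia|].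
  by apply: eval_add; [apply: eval_cst; lia|exact: eval_reg|lia].
apply: runs_seq; apply: (runs_assign (a := 0)); first by apply: eval_cst; lia.
apply: (@runs_weaken w S _ _ _ _ (I2 nb)); [|exact: leqnn|].
  apply: (runs_while (T := 20)) => //.
    move=> k st kb [r3 r4 [c0 c1 c2 c3] ptr].
    exists 1.
      have := @eval_ltn w S st (Reg 4) (Reg 3) k nb; rewrite kb.
      by apply; apply: eval_reg.
    split=> //; apply: (@runs_weaken w S _ _ _ _ _ _); [|shelve|by move=> st' H; exact: H].
    apply: runs_seq; apply: (runs_write (a := k + 4) (b := 3)); [|by apply: eval_cst; lia|lia|].
      by apply: eval_add; [exact: eval_reg|apply: eval_cst; lia|lia].
    apply: (runs_assign (a := k + 1)).
      by apply: eval_add; [exact: eval_reg|apply: eval_cst; lia|lia].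
    split=> //=; first by rewrite update_eq addn1.
      by split; rewrite update_neq //; lia.
    move=> j; rewrite ltnS leq_eqVlt => /orP[/eqP->|jk]; first by rewrite update_eq.
    by rewrite update_neq ?ptr //; lia.
  move=> st [r3 r4 _ _]; have := @eval_ltn w S st (Reg 4) (Reg 3) nb nb.
  by rewrite ltnn; apply; apply: eval_reg.
move=> st [_ _ [c0 c1 c2 c3] ptr]; split=> //.
- by rewrite c2 big1 ?addn0.
- by move=> j jn _; apply: ptr.
- by move=> j jn; rewrite ptr.
- by move=> j i jn iB; rewrite counter_width0.
- by move=> j jn; rewrite /=; lia.
Unshelve.
- by rewrite /=; lia.
- by [].
Qed.

(** Induction on the operations, with the moves already made on the left. An insertion costs two
    increments and one assignment, at most [2 * 300 + 2] in amortized time. *)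
Lemma maintains_run m (ops : seq (dyn_op n)) F M gam d :
  Tot = 2 * m ->
  represents gam d M -> grown gam d ->
  (forall v : 'I_n, d v = degree F v) -> (forall v, n <= v -> d v = 0) ->
  all_pairs F -> (forall e : {set 'I_n}, e \in inserted ops -> #|e| = 2) -> uniq (inserted ops) ->
  (forall e : {set 'I_n}, e \in inserted ops -> e \notin F) -> #|F| + size (inserted ops) = m ->
  exists2 t, maintains degrees w S F M ops t &
    t + 60 * (B * \sum_(j < nb) gam j) <=
      700 * size (inserted ops) + 100 * nqueries ops + 60 * (B * nb + Tot).
Proof.
move=> TotE; elim: ops F M gam d => [|op ops IH] F M gam d rep gr dF d0 F2 new2 uniq_new newF Fm.
  (* When no operation remains, [grows_cost] bounds the moves of the whole run. *)
  exists 0; first exact: maintains_nil.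
  have := grows_cost gr.
  rewrite (total_degrees d0) (eq_bigr (fun v => degree F v)) // handshake //.
  by move: Fm TotE => /=; rewrite addn0; lia.
have totE : \sum_(j < nb) block_sum d j = 2 * #|F|.
  by rewrite (total_degrees d0) (eq_bigr (fun v => degree F v)) ?handshake.
case: op new2 uniq_new newF Fm => [u v|v] new2 uniq_new newF Fm; last first.
  have topS : M 2 <= S.
    by apply: (top_le rep gr); rewrite totE; move: Fm TotE => /=; lia.
  have := query_runs (st := State (nth 0 [:: val v]) M) rep topS erefl (ltn_ord v).
  move=> /runs_call[t [M' [r [E le_t [rs [[/= eM r0] er]]]]]].
  rewrite {}eM -{}er {}r0 dF in E.
  have [t2 H2 le2] := IH F M gam d rep gr dF d0 F2 new2 uniq_new newF Fm.
  exists (t + t2); first exact: maintains_query E H2.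
  rewrite /nqueries /= -/(nqueries ops).
  by move: (B * \sum_(j < nb) gam j) (B * nb) le2 => x y; lia.
set e := [set u; v]; have ein : e \in inserted (Insert u v :: ops) by rewrite inE eqxx.
have e2 : #|e| = 2 by apply: new2.
have eF : e \notin F by apply: newF.
have uv : u != v by move: e2; rewrite cards2; case: (u != v).
have F2' : all_pairs (e |: F) by move=> x /setU1P[->|/F2].
have degE x : degree (e |: F) x = (x \in e) + degree F x by apply: degree_setU1.
(* The degree in the enlarged edge set is still below [n]. *)
have dlt x : x \in e -> (d x).+1 < n.
  by move=> xe; have := degree_lt x F2'; rewrite degE xe dF.
have tot : 2 * #|F| + 2 <= Tot by move: Fm TotE => /=; lia.
have [|gam1 [T1 [gr1 le1 run1]]] := incr_runs
  (st := State (nth 0 [:: val u; val v]) M) rep gr erefl (ltn_ord u) (dlt u (set21 _ _)).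
  by rewrite totE; lia.
set d1 := update d u _ in gr1 run1.
have d1v : d1 v = d v by rewrite /d1 update_neq // eq_sym.
pose d2 := update d1 v (d1 v).+1.
(* The second increment takes its vertex from register 1; as [u != v], its counter was not touched
   by the first. *)
have {}run1 : exists gam2 T2, [/\ grown gam2 d2,
    T1 + T2 + 60 * (B * \sum_(j < nb) gam j)
      <= 600 + 60 * (B * \sum_(j < nb) gam2 j)
  & runs w S (dd_insert degrees) (State (nth 0 [:: val u; val v]) M) (T1 + (2 + T2))
      (fun st => represents gam2 d2 (cells st))].
  have [t1 [st1 [E1 lt1 [r1 rep1]]]] := run1.
  have [| |gam2 [T2 [gr2 le2 run2]]] := incr_runs
    (st := State (update (regs st1) 0 v) (cells st1)) (v := v) rep1 gr1 erefl (ltn_ord v).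
  - by rewrite d1v; apply: dlt; rewrite set22.
  - by rewrite /d1 total_incr // totE; lia.
  exists gam2, T2; split=> //; first by lia.
  apply: runs_seq; exists t1, st1; split=> //; apply: runs_seq.
  apply: (runs_assign (a := v)); first by rewrite /= r1.
  by apply: runs_weaken run2 (leqnn _) _ => st2 [].
have [gam2 [T2 [gr2 le2 /runs_call[t1 [M2 [r [E1 lt1 [rs [/= rep2 _]]]]]]]]] := run1.
have [||||||t2 H2 le3] := IH (e |: F) M2 gam2 d2 rep2 gr2 _ _ F2'.
- move=> x; rewrite degE /d2 d1v; have [->|nv] := eqVneq x v.
    by rewrite update_eq set22 dF.
  rewrite update_neq // /d1; have [->|nu] := eqVneq x u.
    by rewrite update_eq set21 dF.
  by rewrite update_neq // dF !inE (negPf nv) (negPf nu).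
- move=> x nx; rewrite /d2 /d1 !update_neq ?d0 //.
    by apply: contraTneq nx => ->; rewrite -ltnNge.
  by apply: contraTneq nx => ->; rewrite -ltnNge.
- by move=> x xin; apply: new2; rewrite inE xin orbT.
- by case/andP: uniq_new.
- move=> x xin; rewrite !inE negb_or newF ?andbT; last by rewrite inE xin orbT.
  by case/andP: uniq_new => /= nin _; apply: contraNneq nin => xe; rewrite -/e -xe.
- by rewrite cardsU1 eF; move: Fm TotE => /=; lia.
exists (t1 + t2); first exact: maintains_insert E1 H2.
rewrite /nqueries /= -/(nqueries ops).
move: (B * \sum_(j < nb) gam j) (B * \sum_(j < nb) gam2 j) (B * nb) le2 le3 => x y z.
by lia.
Qed.

End Dynamic.

(** * Static storage *)

(* Unary code: the lowest set bit of [enc (g :: s)] is at position [g], and what lies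
   above it is [enc s]. *)
Fixpoint enc (s : seq nat) : nat := if s is g :: s' then 2 ^ g * (2 * enc s').+1 else 0.

(** [logn 2 x] counts trailing zeros; the further halving removes the marker bit. *)
Fixpoint dec (x i : nat) : nat :=
  if i is i'.+1 then dec (x %/ 2 ^ logn 2 x %/ 2) i' else logn 2 x.

Lemma dec_enc s i : i < size s -> dec (enc s) i = nth 0 s i.
Proof.
have logE g y : logn 2 (2 ^ g * (2 * y).+1) = g.
  rewrite lognM ?expn_gt0 // pfactorK // logn_coprime ?addn0 //.
  by rewrite coprime2n /= mul2n odd_double.
elim: s i => // g s IH [|i] /=; rewrite logE // ltnS => lt.
rewrite mulKn ?expn_gt0 // -addn1 mulnC divnMDl // divn_small // addn0.
exact: IH.
Qed.

Lemma enc_lt s : enc s < 2 ^ (sumn s + size s).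
Proof.
elim: s => // g s IH /=; rewrite -addnA expnD ltn_pmul2l ?expn_gt0 // addnS expnS.
by lia.
Qed.

Fixpoint pack (f : nat -> nat) (l q : nat) : nat :=
  if q is q'.+1 then pack f l q' + f q' * 2 ^ (l * q') else 0.

Lemma pack_lt f l q : (forall i, f i < 2 ^ l) -> pack f l q < 2 ^ (l * q).
Proof.
move=> fl; elim: q => [|q IH] /=; first by rewrite muln0.
rewrite mulnS expnD; apply: (@leq_trans (2 ^ (l * q) + f q * 2 ^ (l * q))).
  by rewrite ltn_add2r.
by rewrite -mulSn leq_mul2r fl orbT.
Qed.

Lemma field_pack f l q i :
  (forall i, f i < 2 ^ l) -> i < q -> field (pack f l q) (l * i) l = f i.
Proof.
move=> fl; elim: q => // q IH; rewrite ltnS leq_eqVlt => /orP[/eqP->|lt] /=.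
  by apply: field_top => //; apply: pack_lt.
by rewrite field_add_above ?IH // -mulnSr leq_mul2l lt orbT.
Qed.

(** * The partition of the vertices into classes, and its codes *)

Section Classes.

Variables (g : nat -> nat) (K : nat).
(* A class is a maximal run of vertices with the same window. *)
Definition weight (v : nat) : nat := \sum_(u < v) (g u).+1.
Definition window (v : nat) : nat := weight v %/ K.
(** Vertex 0 is not counted, so that classes are numbered from 0. *)
Definition class_change (v : nat) : nat :=
  if v is u.+1 then (window v != window u : nat) else 0.
Definition class (v : nat) : nat := \sum_(u < v.+1) class_change u.

Lemma weightS v : weight v.+1 = weight v + (g v).+1.
Proof. by rewrite /weight big_ord_recr. Qed.

(** Every vertex weighs at least 1; this bounds the number of vertices in a class by [K]. *)
Lemma weight_mono u v : u <= v -> weight u + (v - u) <= weight v.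
Proof.
move=> /subnK <-; rewrite addnK; elim: (v - u) => [|k IH]; first by rewrite addn0.
by rewrite addSn weightS; lia.
Qed.

Lemma window_mono u v : u <= v -> window u <= window v.
Proof. by move=> le; apply: leq_div2r; have := weight_mono le; lia. Qed.

Lemma classS v : class v.+1 = class v + (window v.+1 != window v).
Proof. by rewrite /class big_ord_recr. Qed.

Lemma class_mono u v : u <= v -> class u <= class v.
Proof.
move=> /subnK <-; elim: (v - u) => // k IH; rewrite addSn classS.
exact: leq_trans IH (leq_addr _ _).
Qed.

(** Each new class raises the window by at least 1, so there are [O(n / K)] classes once the total
    weight is [O(n)]. *)
Lemma class_le v : class v <= window v.
Proof.
elim: v => [|v IH]; first by rewrite /class big_ord1.
rewrite classS; have := window_mono (leqnSn v).
by case: eqP => [->|ne] /=; lia.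
Qed.

Lemma class_window u v : u <= v -> class u = class v -> window u = window v.
Proof.
move=> /subnK <-; elim: (v - u) => // k IH; rewrite addSn classS => e.
have := class_mono (leq_addl k u) => le.
rewrite IH; first by case: eqP e => //= _; lia.
by move: e; case: eqP; lia.
Qed.

Hypothesis K_gt0 : 0 < K.

Lemma same_class_weight u v : u <= v -> class u = class v -> weight v < weight u + K.
Proof.
move=> le e; have := class_window le e; rewrite /window => E.
by rewrite (divn_eq (weight v) K) (divn_eq (weight u) K) E; have := ltn_pmod (weight v) K_gt0; lia.
Qed.

(** Always [K] entries: those of later classes are replaced by 0 and large values are cut off at
    [K], which keeps the code short. *)
Definition class_code (s : nat) : nat :=
  enc [seq (class (s + i) == class s) * minn (g (s + i)) K | i <- iota 0 K].

(** All members of the class but the last have sum below [K], because the weight of the last one is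
    in the same window; the last entry adds at most [K]. *)
Lemma class_entries s k :
  \sum_(i < k) (class (s + i) == class s) * minn (g (s + i)) K <= 2 * K.
Proof.
elim: k => [|k IH]; first by rewrite big_ord0.
rewrite big_ord_recr /=; have [e|] := eqVneq (class (s + k)) (class s); last by rewrite addn0.
rewrite mul1n mul2n -addnn leq_add ?geq_minr //.
have := same_class_weight (leq_addr k s) (esym e); suff: weight s +
  \sum_(i < k) (class (s + i) == class s) * minn (g (s + i)) K <= weight (s + k).
  by move: (\sum_(i < k) _) => x; lia.
elim: (k) => [|h IHh]; first by rewrite big_ord0 !addn0.
rewrite big_ord_recr /= addnS weightS; move: (\sum_(i < h) _) IHh => x IHh.
by have := geq_minl (g (s + h)) K; case: (_ == _); rewrite ?mul1n ?mul0n; lia.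
Qed.

Lemma class_code_lt s : class_code s < 2 ^ (3 * K).
Proof.
apply: leq_trans (enc_lt _) _; rewrite leq_exp2l // size_map size_iota.
suff: sumn [seq (class (s + i) == class s) * minn (g (s + i)) K | i <- iota 0 K] <= 2 * K.
  by move: (sumn _) => x; lia.
have -> : iota 0 K = index_iota 0 K by rewrite /index_iota subn0.
by rewrite sumnE big_map big_mkord; apply: class_entries.
Qed.

Lemma dec_class_code s v : s <= v -> class s = class v ->
  v - s < K /\ dec (class_code s) (v - s) = minn (g v) K.
Proof.
move=> le e; have lt : v - s < K.
  by have := same_class_weight le e; have := weight_mono le; lia.
split=> //; rewrite dec_enc ?size_map ?size_iota // (nth_map 0) ?size_iota //.
by rewrite nth_iota // add0n subnKC // e eqxx mul1n.
Qed.

Definition group_code (k : nat) : nat :=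
  enc [seq class_change (k * K + i) | i <- iota 0 K].

(** The entries are 0 or 1, which gives at most [2 * K] bits; the weaker bound matches that of class
    codes, for common table sizes. *)
Lemma group_code_lt k : group_code k < 2 ^ (3 * K).
Proof.
apply: leq_trans (enc_lt _) _; rewrite leq_exp2l // size_map size_iota.
suff: sumn [seq class_change (k * K + i) | i <- iota 0 K] <= K by move: (sumn _) => x; lia.
rewrite sumnE big_map; apply: (@leq_trans (\sum_(i <- iota 0 K) 1)); last first.
  by rewrite sum1_size size_iota.
by apply: leq_sum => i _; case: (k * K + i) => //= u; case: eqP.
Qed.

Lemma class_groupE v :
  class v = \sum_(u < v %/ K * K) class_change u
            + \sum_(i < (v %% K).+1) dec (group_code (v %/ K)) i.
Proof.
have -> : class v = class (v %/ K * K + v %% K) by rewrite -divn_eq.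
rewrite /class -addnS big_split_ord /=; congr (_ + _).
apply: eq_bigr => i _; have iK : i < K.
  by apply: leq_trans (ltn_ord i) _; rewrite ltn_mod.
by rewrite dec_enc ?size_map ?size_iota // (nth_map 0) ?size_iota // nth_iota.
Qed.

(** Truncated subtraction gives 0 unless [K < g u], which only the last vertex of a class can
    satisfy; the maximum picks out that value. *)
Definition excess n c : nat := \max_(u < n | class u == c) (g u - K).

(* A vertex with [K <= g v] is the last one of its class, and all the others in the class
   have smaller values. *)
Lemma excessE n v : v < n -> K <= g v -> excess n (class v) = g v - K.
Proof.
move=> vn Kg; apply/eqP; rewrite eqn_leq; apply/andP; split; last first.
  exact: (@leq_bigmax_cond _ (fun u : 'I_n => class u == class v) (fun u => g u - K) (Ordinal vn)).
apply/bigmax_leqP => u /eqP e; have [uv|vu|->] := ltngtP u v; last by [].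
  by have := same_class_weight (ltnW uv) e; have := weight_mono uv; rewrite weightS; lia.
by have := same_class_weight (ltnW vu) (esym e); have := weight_mono vu; rewrite weightS; lia.
Qed.

Definition class_start n c : nat := index c (mkseq class n).

Lemma class_startP n v (s := class_start n (class v)) :
  v < n -> s <= v /\ class s = class v.
Proof.
move=> vn; have mem_v : class v \in mkseq class n.
  by apply/mapP; exists v; rewrite ?mem_iota.
have sn : s < n by rewrite /s -{2}(size_mkseq class n) index_mem.
split; last by rewrite -(nth_mkseq 0 class sn) nth_index.
rewrite leqNgt; apply/negP => /(before_find 0) /=.
by rewrite nth_mkseq ?eqxx.
Qed.

End Classes.

(** * The static memory and the constant-time query *)

Definition region (r : nat) (e : expr) : expr :=
  Read (Bin Add (Bin Mul (Cst 16) e) (Cst r)).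

(** Register 1 holds the group of the vertex, register 2 its class, and register 3 the high part,
    first cut off at [K] and then with the excess added. Interleaving makes addresses independent of
    array lengths; the parameters are constant arrays. *)
Definition static_query : cmd :=
  let q := region 0 (Cst 0) in let l := region 1 (Cst 0) in let K := region 2 (Cst 0) in
  Seq (Assign 1 (Bin Div (Reg 0) K))
  (Seq (Assign 2 (Bin Add (region 4 (Reg 1))
          (region 10 (Bin Add (Bin Mul (region 5 (Reg 1)) K) (Bin Mod (Reg 0) K)))))
  (Seq (Assign 3 (region 9 (Bin Add (Bin Mul (region 7 (Reg 2)) K)
                                    (Bin Defs.Sub (Reg 0) (region 6 (Reg 2))))))
  (Seq (Assign 3 (Bin Add (Reg 3) (Bin Mul (Bin Eqn (Reg 3) K) (region 8 (Reg 2)))))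
       (Assign 0 (Bin Add (Bin Shl (Reg 3) l)
          (Bin Mod (Bin Shr (region 3 (Bin Div (Reg 0) q)) (Bin Mul l (Bin Mod (Reg 0) q)))
                   (Bin Shl (Cst 1) l))))))).

(* Eleven arrays, interleaved modulo 16. *)
Definition static_memory (w n l K : nat) (d : nat -> nat) : memory :=
  let q := w %/ l in let g v := d v %/ 2 ^ l in
  fun a => let k := a %/ 16 in
  nth 0 [:: q; l; K;
    pack (fun i => d (k * q + i) %% 2 ^ l) l q;
    \sum_(u < k * K) class_change g K u;
    group_code g K k;
    class_start g K n k;
    class_code g K (class_start g K n k);
    excess g K n k;
    dec (k %/ K) (k %% K);
    \sum_(i < (k %% K).+1) dec (k %/ K) i] (a %% 16) %% 2 ^ w.

Lemma static_memory_word w n l K d : wordmem w (static_memory w n l K d).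
Proof. by move=> a; rewrite ltn_mod expn_gt0. Qed.

Lemma table_index_lt x i K P : x < P -> i < K -> x * K + i < P * K.
Proof. by move=> xP iK; have := leq_mul xP (leqnn K); rewrite mulSn; lia. Qed.

Section StaticQuery.

Variables (w n l K N : nat) (d : nat -> nat).
Let q := w %/ l.
Let g v := d v %/ 2 ^ l.
Let S := 16 * N.+1.
Let M := static_memory w n l K d.
Hypothesis l_gt0 : 0 < l.
Hypothesis l_lt : l < w.
Hypothesis K_gt0 : 0 < K.
Hypothesis S_le : S <= 2 ^ w.
Hypothesis n_le : n <= 2 ^ w.
Hypothesis d_lt : forall v, v < n -> d v < 2 ^ w.
Hypothesis low_fits : n %/ q <= N.
Hypothesis classes_fit : window g K n <= N.
Hypothesis tables_fit : 2 ^ (3 * K) * K <= N.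

Lemma eval_region s r e k :
  cells s = M -> r < 16 -> eval w S s e = Some k -> k <= N ->
  eval w S s (region r e) = Some (M (16 * k + r)).
Proof.
move=> eM r16 ek kN; have kS : 16 * k + r < S by rewrite /S; lia.
apply: eval_read (_ : _ = Some (16 * k + r)) kS _; last by rewrite eM.
have w16 : 16 < 2 ^ w by move: S_le; rewrite /S; lia.
apply: eval_add; [apply: eval_mul ek _ => //; [exact: eval_cst|]|apply: eval_cst|]; lia.
Qed.

Lemma cellE r k : r < 16 -> M (16 * k + r) = (nth 0 [:: q; l; K;
    pack (fun i => d (k * q + i) %% 2 ^ l) l q;
    \sum_(u < k * K) class_change g K u;
    group_code g K k;
    class_start g K n k;
    class_code g K (class_start g K n k);
    excess g K n k;
    dec (k %/ K) (k %% K);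
    \sum_(i < (k %% K).+1) dec (k %/ K) i] r) %% 2 ^ w.
Proof.
move=> r16; rewrite /M /static_memory [16 * k]mulnC divnMDl // modnMDl.
by rewrite (modn_small r16) (divn_small r16) addn0.
Qed.

Lemma static_query_call v : v < n -> exists2 t, t <= 300 &
  call w S static_query [:: v] M t M (d v).
Proof.
move=> vn.
have w2 : w < 2 ^ w by apply: ltn_expl.
have NS : N < 2 ^ w by move: S_le; rewrite /S; lia.
have pK : 0 < 2 ^ (3 * K) by rewrite expn_gt0.
have KN : K <= N by apply: leq_trans tables_fit; apply: leq_pmull.
have p3N : 2 ^ (3 * K) <= N by apply: leq_trans tables_fit; apply: leq_pmulr.
have q_gt0 : 0 < q by rewrite divn_gt0 // ltnW.
have vw : v < 2 ^ w by apply: leq_trans n_le.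
have cvN : class g K v <= N.
  apply: leq_trans classes_fit; apply: leq_trans (class_le g K v) _.
  exact: (window_mono g K (ltnW vn)).
(* There are no more groups than windows, as each vertex weighs at least 1. *)
have vKN : v %/ K <= N.
  apply: leq_trans classes_fit; apply: leq_div2r.
  by have := weight_mono g (ltnW vn); have := weight_mono g (leq0n v); lia.
have vqN : v %/ q <= N by apply: leq_trans low_fits; apply: leq_div2r; apply: ltnW.
have [sv csv] := class_startP g K vn; set s := class_start g K n _ in sv csv.
have [posK decE] := dec_class_code K_gt0 sv csv.
have ccN := class_code_lt g K_gt0 s; have gcN := group_code_lt g K_gt0 (v %/ K).
have tabN x i : x < 2 ^ (3 * K) -> i < K -> x * K + i <= N.
  by move=> xl iK; apply: leq_trans tables_fit; apply: ltnW; apply: table_index_lt.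
have tabW x i : x < 2 ^ (3 * K) -> i < K -> x * K + i < 2 ^ w.
  by move=> xl iK; apply: leq_ltn_trans (tabN x i xl iK) NS.
have rowW x i : x < 2 ^ (3 * K) -> i < K -> x * K < 2 ^ w.
  by move=> xl iK; apply: leq_ltn_trans (leq_addr i _) (tabW x i xl iK).
have one : 1 < 2 ^ w by apply: leq_ltn_trans w2; apply: leq_ltn_trans l_lt.
have iK : v %% K < K by rewrite ltn_mod.
have classE := class_groupE g K_gt0 v.
(* A decoded value [K] signals a possible excess; for [g v = K] the excess is 0. *)
have gK : minn (g v) K + (minn (g v) K == K) * (excess g K n (class g K v)) = g v.
  have [lt|ge] := ltnP (g v) K; first by rewrite (ltn_eqF lt) addn0.
  by rewrite eqxx mul1n excessE // subnKC.
have gv : g v <= d v by apply: leq_div.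
have dv := d_lt vn.
have ev0 k st : cells st = M -> k < 3 -> eval w S st (region k (Cst 0)) =
    Some (nth 0 [:: q; l; K] k).
  move=> eM k3; rewrite (eval_region (k := 0) eM) ?eval_cst ?expn_gt0 //; last by lia.
  rewrite cellE; last by lia.
  case: k k3 => [|[|[|k]]] // _; rewrite /= modn_small //.
  + by apply: leq_ltn_trans w2; apply: leq_div.
  + exact: ltn_trans w2.
  + exact: leq_ltn_trans NS.
suff [t [[rs M'] [E le_t [/= eM e0]]]] : runs w S static_query (State (nth 0 [:: v]) M) 300
    (fun st => cells st = M /\ regs st 0 = d v).
  by rewrite eM in E; exists t => //; exists rs.
apply: (@runs_weaken w S _ _ _ _ _ _); [|shelve|by move=> st' H; exact: H].
apply: runs_seq; apply: (runs_assign (a := v %/ K)).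
  by apply: eval_div; [exact: eval_reg | exact: (ev0 2)].
apply: runs_seq; apply: (runs_assign (a := class g K v)).
  set st1 := State _ _; rewrite classE; apply: eval_add; last by rewrite -classE; apply: leq_ltn_trans NS.
    rewrite (eval_region (k := v %/ K)) // cellE //= modn_small //.
    by apply: leq_ltn_trans NS; apply: leq_trans cvN; rewrite classE leq_addr.
  rewrite (eval_region (k := group_code g K (v %/ K) * K + v %% K)) //; last 2 first.
  - apply: eval_add.
    + apply: eval_mul; [|exact: (ev0 2)|].
        rewrite (eval_region (k := v %/ K)) // cellE //= modn_small //.
        by apply: ltn_trans gcN _; apply: leq_ltn_trans NS.
      exact: rowW gcN iK.
    + by apply: eval_mod; [exact: eval_reg | exact: (ev0 2)].
    + exact: tabW gcN iK.
  - exact: tabN gcN iK.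
  rewrite cellE //= divnMDl // (divn_small iK) addn0 modnMDl (modn_small iK) modn_small //.
  by apply: leq_ltn_trans NS; apply: leq_trans cvN; rewrite classE leq_addl.
apply: runs_seq; apply: (runs_assign (a := minn (g v) K)).
  rewrite -decE (eval_region (k := class_code g K s * K + (v - s))) //; last 2 first.
  - apply: eval_add.
    + apply: eval_mul; [|exact: (ev0 2)|].
        rewrite (eval_region (k := class g K v)) // cellE //= modn_small //.
        by apply: ltn_trans ccN _; apply: leq_ltn_trans NS.
      exact: rowW ccN posK.
    + apply: eval_sub; [exact: eval_reg | | exact: sv |exact: vw].
      rewrite (eval_region (k := class g K v)) // cellE //= modn_small //.
      exact: leq_ltn_trans sv vw.
    + exact: tabW ccN posK.
  - exact: tabN ccN posK.
  rewrite cellE //= divnMDl // (divn_small posK) addn0 modnMDl (modn_small posK) modn_small //.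
  by rewrite decE; apply: leq_ltn_trans NS; apply: leq_trans KN; apply: geq_minr.
apply: runs_seq; apply: (runs_assign (a := g v)).
  apply: etrans (congr1 Some gK); apply: eval_add; [exact: eval_reg| |by rewrite gK; apply: leq_ltn_trans gv dv].
  have exw : excess g K n (class g K v) < 2 ^ w.
    have pw : 0 < 2 ^ w by rewrite expn_gt0.
    rewrite -(prednK pw) ltnS; apply/bigmax_leqP => u _; rewrite -ltnS (prednK pw).
    apply: leq_ltn_trans (d_lt (ltn_ord u)).
    exact: leq_trans (leq_subr _ _) (leq_div _ _).
  apply: eval_mul; [|rewrite (eval_region (k := class g K v)) // cellE //= modn_small //|].
    by apply: eval_eqn; [exact: eval_reg | exact: (ev0 2)].
  by case: eqP; rewrite ?mul1n ?mul0n ?expn_gt0.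
have fl i : d (v %/ q * q + i) %% 2 ^ l < 2 ^ l by rewrite ltn_mod expn_gt0.
apply: (runs_assign (a := d v)); last by [].
rewrite (divn_eq (d v) (2 ^ l)); apply: eval_add; last by rewrite -divn_eq.
  apply: eval_shl; [exact: eval_reg | exact: (ev0 1) |].
  by apply: leq_ltn_trans dv; apply: leq_divM.
have -> : d v %% 2 ^ l = field (pack (fun i => d (v %/ q * q + i) %% 2 ^ l) l q) (l * (v %% q)) l.
  by rewrite field_pack // -?divn_eq // ltn_mod.
apply: eval_mod; last first.
  rewrite -[2 ^ l]mul1n; apply: eval_shl; [exact: eval_cst|exact: (ev0 1)|].
  by rewrite mul1n ltn_exp2l.
apply: eval_shr.
  rewrite (eval_region (k := v %/ q)) //.
    rewrite cellE //= modn_small //; apply: leq_trans (pack_lt q fl) _.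
    by rewrite leq_exp2l // mulnC leq_divM.
  by apply: eval_div; [exact: eval_reg | exact: (ev0 0)].
apply: eval_mul; [exact: (ev0 1) | by apply: eval_mod; [exact: eval_reg | exact: (ev0 0)] |].
(* A bit position inside a packed word is at most [l * q <= w]. *)
apply: leq_ltn_trans w2; apply: leq_trans (leq_divM w l); rewrite mulnC leq_mul2r.
by rewrite ltnW ?orbT // ltn_mod.
Unshelve. by [].
Qed.

End StaticQuery.

(** * Space and time bounds *)

(** For [m < n] the quotient is 0 and [trunc_log] returns 0, leaving one bit. *)
Definition field_bits (n m : nat) : nat := (trunc_log 2 (m %/ n)).+1.

(** [m %/ n < 2 ^ field_bits n m]; it follows that the high parts of the degrees have sum at most
    [2 * n]. *)
Lemma edges_le_field_bits n m : 0 < n -> m <= n * 2 ^ field_bits n m.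
Proof.
move=> n0; apply: ltnW; apply: leq_trans (ltn_ceil m n0) _.
by rewrite mulnC leq_mul2l (trunc_log_ltn _ (isT : 1 < 2)) orbT.
Qed.

Lemma trunc_log_succ_le n : 0 < n -> (trunc_log 2 n).+1 <= n.
Proof. by move=> n0; apply: leq_trans (ltn_expl _ _) (trunc_logP _ n0). Qed.

Lemma edges_le n (F : {set {set 'I_n}}) : all_pairs F -> #|F| <= n * n.
Proof.
move=> F2; have := handshake F2; suff: \sum_v degree F v <= n * n by lia.
apply: (@leq_trans (\sum_(v < n) n)); last by rewrite sum_nat_const card_ord.
by apply: leq_sum => v _; apply: ltnW; apply: degree_lt.
Qed.

Section Bounds.

Variables kappa n w m : nat.
Let t := trunc_log 2 n.
Let l := field_bits n m.
Hypothesis n_gt0 : 0 < n.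
Hypothesis w_ge : 32 <= w.
Hypothesis n_le : n ^ 2 <= 2 ^ w.
Hypothesis w_le : w <= kappa * t.+1.
Hypothesis m_le : m <= n * n.

Lemma pow_trunc_log_le : 2 ^ t <= n.
Proof. exact: trunc_logP. Qed.

Lemma double_trunc_log_le : t + t <= w.
Proof.
rewrite -(leq_exp2l _ _ (isT : 1 < 2)); apply: leq_trans n_le.
by rewrite expnD -mulnn leq_mul // pow_trunc_log_le.
Qed.

(** After squaring, the product of [256 ^ 2 <= 2 ^ w] and [n ^ 2 <= 2 ^ w]. *)
Lemma vertices_le : 256 * n <= 2 ^ w.
Proof.
rewrite -(leq_exp2r _ _ (isT : 0 < 2)) expnMn -expnM muln2 -addnn expnD.
apply: leq_mul n_le; rewrite -[256]/(2 ^ 8) -expnM leq_exp2l //.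
by apply: leq_trans w_ge.
Qed.

Lemma field_bits_le : l <= t.+1.
Proof.
rewrite ltnS; apply: leq_trunc_log; apply: leq_trans (leq_div2r n m_le) _.
by rewrite mulnK.
Qed.

Lemma field_bits_lt : l < w.
Proof. by have := field_bits_le; have := double_trunc_log_le; lia. Qed.

Lemma word_le : w <= kappa * n.
Proof.
by apply: leq_trans w_le _; rewrite leq_mul2l trunc_log_succ_le ?orbT.
Qed.

(** About an eighth of [lg n], so that the tables have only [O(sqrt n)] rows while the number of
    classes stays [O(n / lg n)]. *)
Definition group_size : nat := (t %/ 8).+1.
(** The terms stand for words of low parts, classes and table rows; [3 * n] bounds the total weight,
    namely 1 per vertex plus the high parts. *)
Definition static_cells : nat :=
  n %/ (w %/ l) + (3 * n) %/ group_size + 2 ^ (3 * group_size) * group_size.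

Lemma trunc_log_le_groups : t.+1 <= 8 * group_size.
Proof. by rewrite /group_size; have := ltn_ceil t (isT : 0 < 8); lia. Qed.

Lemma table_le : 2 ^ (3 * group_size) * group_size <= 8 * 2 ^ (4 * (t %/ 8)).
Proof.
rewrite /group_size; move: (t %/ 8) => a.
have -> : 3 * a.+1 = 3 + 3 * a by lia.
have -> : 4 * a = 3 * a + a by lia.
rewrite !expnD -mulnA leq_mul2l leq_mul2l.
by rewrite ltn_expl ?orbT.
Qed.

Lemma static_cells_fit : 16 * static_cells.+1 <= 2 ^ w.
Proof.
apply: leq_trans vertices_le; have n1 := pow_trunc_log_le.
have : 2 ^ (4 * (t %/ 8)) <= 2 ^ t by rewrite leq_exp2l //; lia.
have := table_le; have := leq_div n (w %/ l); have := leq_div (3 * n) group_size.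
rewrite /static_cells; move: (_ %/ group_size) (n %/ _) (2 ^ (3 * _) * _) (2 ^ (4 * _)).
by move=> x y z u; lia.
Qed.

Lemma static_cells_space : 16 * static_cells.+1 * w <= 1500 * kappa.+1 * (n * l).
Proof.
have n1 := pow_trunc_log_le; have l_gt0 : 0 < l by [].
have h1 : n %/ (w %/ l) * w <= 2 * (n * l).
  (* As [w %/ l >= 1], rounding down loses at most a factor 2. *)
  have wq : w <= 2 * (w %/ l * l).
    have := ltn_ceil w l_gt0; have : 0 < w %/ l by rewrite divn_gt0 // ltnW // field_bits_lt.
    by move: (w %/ l) => q q0; nia.
  apply: leq_trans (leq_mul (leqnn _) wq) _.
  by have := leq_mul (leq_divM n (w %/ l)) (leqnn l); lia.
have h2 : (3 * n) %/ group_size * w <= 24 * kappa * n.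
  apply: leq_trans (leq_mul (leqnn _) w_le) _.
  apply: (@leq_trans ((3 * n) %/ group_size * (kappa * (8 * group_size)))).
    by rewrite !leq_mul // trunc_log_le_groups.
  by have := leq_divM (3 * n) group_size; nia.
have h3 : 2 ^ (3 * group_size) * group_size * w <= 64 * kappa * n.
  apply: leq_trans (leq_mul table_le w_le) _.
  (* The logarithmic word length is absorbed by a further factor [2 ^ (t %/ 8)], and five eighths of
     [t] are still at most [t]. *)
  have g2 : t.+1 <= 8 * 2 ^ (t %/ 8).
    by apply: leq_trans trunc_log_le_groups _; rewrite leq_mul2l ltn_expl.
  apply: leq_trans (leq_mul (leqnn _) (leq_mul (leqnn _) g2)) _.
  have : 2 ^ (4 * (t %/ 8)) * 2 ^ (t %/ 8) <= 2 ^ t by rewrite -expnD leq_exp2l //; lia.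
  by move: (2 ^ (4 * _)) (2 ^ (t %/ 8)) => x y; nia.
have h4 := word_le.
have h5 : n <= n * l by apply: leq_pmulr.
rewrite /static_cells; move: h1 h2 h3 h4 h5.
move: (n * l) (n %/ _) (_ %/ group_size) (2 ^ _ * _) => nl x y z h1 h2 h3 h4 h5.
have := leq_mul (leqnn kappa) h5; lia.
Qed.

Definition num_blocks : nat := (n %/ (w %/ 2)).+1.
(** The threshold [s] is taken as [l + b0], so [2 ^ s >= 2 ^ l * w]. *)
Definition dynamic_cells (b0 : nat) : nat :=
  4 + num_blocks + w %/ 2
  + 3 * (num_blocks * (b0 + 2 * (l + b0)) + 2 * ((2 * m) %/ 2 ^ (l + b0))).

Section DynamicBounds.

Variable b0 : nat.
Hypothesis w_le_b0 : w <= 2 ^ b0.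
Hypothesis b0_lt : b0 < w.

(** One factor [2 ^ b0 >= w] pays for the word length, and [2 ^ l] turns [m] into [n]. *)
Lemma overflow_le : (2 * m) %/ 2 ^ (l + b0) * w <= 2 * n.
Proof.
apply: leq_trans (leq_mul (leqnn _) w_le_b0) _.
have := leq_divM (2 * m) (2 ^ (l + b0)); have := edges_le_field_bits m n_gt0.
rewrite -/l expnD; have : 0 < 2 ^ l by rewrite expn_gt0.
by move: (2 ^ l) (2 ^ b0) (_ %/ _) => y z x; nia.
Qed.

Lemma blocks_le : num_blocks * w <= 3 * n + 3 * w.
Proof.
have := leq_divM n (w %/ 2); have : w <= 3 * (w %/ 2) by lia.
have : w %/ 2 <= w by lia.
by rewrite /num_blocks mulSn; move: (w %/ 2) (n %/ _) => y x; nia.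
Qed.

Lemma dynamic_cells_fit : dynamic_cells b0 <= 2 ^ w.
Proof.
have := vertices_le; have := overflow_le; have := blocks_le.
have := field_bits_lt; have wlt : 256 * (w - 7) <= 2 ^ w.
  have -> : 2 ^ w = 256 * 2 ^ (w - 8) by rewrite -[256]/(2 ^ 8) -expnD subnKC //; lia.
  by rewrite leq_mul2l; have := ltn_expl (w - 8) (isT : 1 < 2); lia.
have : w %/ 2 <= w by lia.
rewrite /dynamic_cells; move: (_ %/ 2 ^ _) num_blocks (w %/ 2) => x nb B.
move=> hB hl h1 h2 h3; have : nb * (b0 + 2 * (l + b0)) <= nb * (5 * w).
  by rewrite leq_mul2l; apply/orP; right; lia.
nia.
Qed.

(** Makes [w ^ 2] an [O(n)], hence also the bits of the [w %/ 2] spare cells. *)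
Lemma square_trunc_log_le : t.+1 ^ 2 <= 4 * n.
Proof.
apply: leq_trans (leq_mul (leqnn 4) pow_trunc_log_le); elim: (t) => [//|u IH].
case: u IH => [//|[//|u]]; rewrite [2 ^ u.+3]expnS -!mulnn.
by move: (2 ^ u.+2) => x; lia.
Qed.

(** The factor [kappa.+1 ^ 2] is due to the term [w * w]; blocks, word length and overflow
    contribute at most one factor [kappa] each. *)
Lemma dynamic_cells_space :
  dynamic_cells b0 * w <= 100 * kappa.+1 ^ 2 * (n * (l + b0)).
Proof.
have h1 := overflow_le; have h2 := blocks_le; have h3 := word_le.
have h4 : w * w <= 4 * kappa ^ 2 * n.
  apply: leq_trans (leq_mul w_le w_le) _; have := square_trunc_log_le.
  rewrite -!mulnn; move: (t.+1) => x; nia.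
have l_gt0 : 0 < l by [].
have : w %/ 2 <= w by lia.
rewrite /dynamic_cells; move: h1 h2; move: (_ %/ 2 ^ _) num_blocks (w %/ 2) => x nb B h1 h2 hB.
set q := l + b0; have q_gt0 : 0 < q by rewrite addn_gt0 l_gt0.
have h5 : n <= n * q by apply: leq_pmulr.
have h6 : B * w <= w * w by rewrite leq_mul2r hB orbT.
have h7 : nb * (b0 + 2 * q) * w <= 3 * q * (3 * n + 3 * w).
  have : b0 + 2 * q <= 3 * q by rewrite /q; lia.
  by move=> hq; have := leq_mul hq h2; lia.
have h8 : q * w <= kappa * (n * q) by have := leq_mul (leqnn q) h3; lia.
have h9 : kappa * n <= kappa * (n * q) by rewrite leq_mul2l h5 orbT.
have h10 : kappa ^ 2 * n <= kappa ^ 2 * (n * q) by rewrite leq_mul2l h5 orbT.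
rewrite -[kappa.+1 ^ 2]mulnn.
have -> : 100 * (kappa.+1 * kappa.+1) * (n * q) =
  100 * (kappa ^ 2 * (n * q)) + 200 * (kappa * (n * q)) + 100 * (n * q).
  by rewrite -mulnn; lia.
have -> : (4 + nb + B + 3 * (nb * (b0 + 2 * q) + 2 * x)) * w =
  4 * w + nb * w + B * w + 3 * (nb * (b0 + 2 * q) * w) + 6 * (x * w) by lia.
move: h7 h8 h6 h10 h9 h4 h1; rewrite -mulnA -[4 * _ * n]mulnA.
move: (nb * (b0 + 2 * q) * w) (kappa ^ 2 * (n * q)) (kappa ^ 2 * n) => y1 y2 y3.
by lia.
Qed.

End DynamicBounds.

End Bounds.

(** * Comparison with real logarithms *)

Section LogBounds.

Variable R : realType.

Lemma lg_ge1 (x : R) : (1 <= lg x)%R.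
Proof. by rewrite /lg le_max lexx. Qed.

Lemma lg_ge_nat (x : R) e : ((2 ^ e)%:R <= x)%R -> (e%:R <= lg x)%R.
Proof.
have ln2 : (0 < ln (2 : R))%R by apply: ln_gt0; rewrite ltr1n.
move=> le; rewrite /lg le_max; apply/orP; right; rewrite ler_pdivlMr //.
rewrite mulr_natl -lnXn // -natrX ler_ln ?posrE // ?ltr0n ?expn_gt0 //.
by apply: lt_le_trans le; rewrite ltr0n expn_gt0.
Qed.

(** One [lg] covers the truncated logarithm, the other the successor, by the clamp at 1. *)
Lemma field_bits_lg n m :
  0 < n -> ((field_bits n m)%:R <= 2 * lg (m%:R / n%:R : R))%R.
Proof.
move=> n0; have ge1 := lg_ge1 (m%:R / n%:R); rewrite /field_bits -addn1 natrD.
rewrite mulr_natl mulr2n lerD // {ge1}.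
have [->|q0] := posnP (m %/ n); first by rewrite trunc_log0 (le_trans ler01) ?lg_ge1.
apply: lg_ge_nat; rewrite ler_pdivlMr ?ltr0n // -natrM ler_nat.
apply: leq_trans (leq_divM m n); rewrite leq_mul2r; apply/orP; right.
exact: trunc_logP.
Qed.

(** [w <= 2 ^ kappa * 2 ^ e.+1] with [e <= lg (lg n)]; the clamp at 1 absorbs the summand
    [kappa.+1]. *)
Lemma up_log_lglg kappa n w : 0 < n -> w <= kappa * (trunc_log 2 n).+1 ->
  ((up_log 2 w)%:R <= kappa.+2%:R * lg (lg (n%:R : R)))%R.
Proof.
move=> n0 wle; set t := trunc_log 2 n in wle; set e := trunc_log 2 t.
have ge1 := lg_ge1 (lg (n%:R : R)).
have le_e : (e%:R <= lg (lg (n%:R : R)))%R.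
  have [t0|t0] := posnP t; first by rewrite /e t0 trunc_log0 (le_trans ler01).
  apply: lg_ge_nat; apply: (@le_trans _ _ (t%:R)%R).
    by rewrite ler_nat trunc_logP.
  by apply: lg_ge_nat; rewrite ler_nat trunc_logP.
have : up_log 2 w <= kappa + e.+1.
  apply: up_log_min => //; rewrite expnD; apply: leq_trans wle _; apply: leq_mul.
    by apply: ltnW; apply: ltn_expl.
  exact: trunc_log_ltn.
rewrite -(ler_nat R) => /le_trans; apply.
rewrite addnS -natr1 natrD -[(kappa.+2%:R)%R]natr1 -[(kappa.+1%:R)%R]natr1 !mulrDl !mul1r.
rewrite -addrA [(e%:R + 1)%R]addrC addrA lerD // lerD // ler_peMr ?ler0n //.
Qed.

End LogBounds.

(** Extended by 0, since blocks and packed words also run over positions beyond the last vertex. *)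
Definition degree_at n (F : {set {set 'I_n}}) (v : nat) : nat :=
  oapp (degree F) 0 (insub v).

Lemma degree_atE n (F : {set {set 'I_n}}) (v : 'I_n) : degree_at F v = degree F v.
Proof. by rewrite /degree_at valK. Qed.

(** * Both structures for a given subgraph *)

Section Assembly.

Variables (kappa n w : nat) (G' : sgraph n).
Let m := #|edges G'|.
Hypothesis n_gt0 : 0 < n.
Hypothesis w_ge : 32 <= w.
Hypothesis n_le : n ^ 2 <= 2 ^ w.
Hypothesis w_le : w <= kappa * (trunc_log 2 n).+1.

Lemma graph_pairs : all_pairs (edges G').
Proof. exact: edges_pairs. Qed.

Lemma degrees_maintained ops : builds ops G' ->
  maintains_from_empty degrees w (dynamic_cells n w m (up_log 2 w)) ops
    (820 * kappa.+1 * (m + n + nqueries ops)).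
Proof.
move=> ops_G' M0 _; set b0 := up_log 2 w; set S := dynamic_cells _ _ _ _.
have b0_gt0 : 0 < b0 by rewrite up_log_gt0 /=; lia.
have w_le_b0 : w <= 2 ^ b0 by apply: up_logP.
have b0_lt : b0 < w.
  have : b0 <= w.-1; last by lia.
  by apply: up_log_min => //; have := ltn_expl w.-1 (isT : 1 < 2); lia.
have b0_min b : b < b0 -> 2 ^ b < w.
  by rewrite !ltnNge; apply: contra; apply: up_log_min.
have B_le : w %/ 2 <= 2 ^ b0 by apply: leq_trans w_le_b0; apply: leq_div.
have m_le : m <= n * n by apply: edges_le; apply: graph_pairs.
have S_le : S <= 2 ^ w by apply: (dynamic_cells_fit n_gt0 w_ge n_le w_le m_le).
have S_ge : 4 + num_blocks n w + w %/ 2 + 3 * (num_blocks n w *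
  (b0 + 2 * (field_bits n m + b0)) + 2 * ((2 * m) %/ 2 ^ (field_bits n m + b0))) <= S by [].
have [t1 [M1 [r [call1 le1 [rs [/= rep _]]]]]] := runs_call
  (init_runs w_ge n_le b0_gt0 b0_lt B_le erefl S_le S_ge w_le_b0 b0_min M0).
have mem_ops e : (e \in inserted ops) = (e \in edges G').
  by rewrite (perm_mem ops_G') mem_enum.
have size_ops : size (inserted ops) = m by rewrite (perm_size ops_G') -cardE.
have [||||||||t2 run2 le2] := maintains_run w_ge n_le b0_gt0 b0_lt B_le erefl S_le S_ge
  w_le_b0 (m := m) (ops := ops) (F := set0) erefl rep.
- by move=> j g _.
- by move=> v; rewrite degree0.
- by [].
- by move=> e; rewrite inE.
- by move=> e; rewrite mem_ops; apply: edges_pairs.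
- by rewrite (perm_uniq ops_G') enum_uniq.
- by move=> e _; rewrite inE.
- by rewrite cards0 size_ops.
exists M1, t1, t2, r; split=> //.
(* The terms in [w] and [b0] count as [kappa * n], whence the factor [kappa.+1] in the time. *)
have wn := word_le n_gt0 w_le.
have {}le2 := leq_trans (leq_addr _ _) le2; rewrite size_ops in le2.
have bn : w %/ 2 * num_blocks n w <= n + w.
  by rewrite /num_blocks mulnS mulnC; have := leq_divM n (w %/ 2); lia.
have nbn : num_blocks n w <= n + 1.
  by rewrite /num_blocks; have := leq_div n (w %/ 2); lia.
have kn : kappa * n <= kappa * (m + n + nqueries ops) by rewrite leq_mul2l; lia.
rewrite -/(num_blocks n w) in le1.
move: le1 le2 bn nbn kn wn; rewrite -[820 * _ * _]mulnA (mulSn kappa).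
move: (num_blocks n w) (w %/ 2 * _) (kappa * n) (kappa * (_ + _)).
by move=> y1 y2 y3 y4; clear -n_gt0 b0_lt; lia.
Qed.

Lemma degrees_stored : let S := 16 * (static_cells n w m).+1 in
  exists M, stores_degrees static_query w S G' M 300.
Proof.
have m_le : m <= n * n by apply: edges_le; apply: graph_pairs.
set l := field_bits n m; set K := group_size n; pose d := degree_at (edges G').
have l_lt : l < w by apply: (field_bits_lt n_gt0 w_ge n_le w_le m_le).
have nw : n <= 2 ^ w by have := vertices_le w_ge n_le; lia.
exists (static_memory w n l K d); split; first exact: static_memory_word.
move=> v; rewrite -degree_atE; apply: static_query_call => //.
- exact: (static_cells_fit n_gt0 w_ge n_le w_le m_le).
- move=> u un; rewrite /d -[u]/(val (Ordinal un)) degree_atE.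
  by apply: leq_trans nw; apply: degree_lt; apply: graph_pairs.
- by rewrite /static_cells -/l -addnA leq_addr.
- rewrite /static_cells -/l -/K addnAC; apply: leq_trans (leq_addl _ _).
  apply: leq_div2r; rewrite /weight; under eq_bigr => i _ do rewrite -addn1.
  rewrite big_split /= sum_nat_const card_ord muln1.
  (* The total weight is [n] plus the high parts, whose sum is at most [2 * m %/ 2 ^ l <= 2 * n]. *)
  suff: \sum_(i < n) d i %/ 2 ^ l <= 2 * n by move: (\sum_(i < n) _) => x; lia.
  apply: leq_trans (sum_divn_le _ _) _; first by rewrite expn_gt0.
  rewrite (eq_bigr (fun v => degree (edges G') v)) => [|i _]; last exact: degree_atE.
  rewrite (handshake graph_pairs) -/m.
  have : 2 * m <= 2 * n * 2 ^ l by rewrite -mulnA leq_mul2l edges_le_field_bits.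
  by move=> /(leq_div2r (2 ^ l)); rewrite mulnK ?expn_gt0.
- by rewrite /static_cells leq_addl.
- exact: ltn_ord.
Qed.

End Assembly.

Theorem theorem6 (R : realType) :
  exists (D : dynamic_degrees) (Q : cmd) (w0 : nat),
  forall kappa : nat, exists C : nat,
  forall (n w : nat), 0 < n -> word_size w0 kappa n w ->
  forall G G' : sgraph n, spanning_subgraph G' G ->
  let m := #|edges G| in
  let d' := avg_degree R G' in
  (forall ops : seq (dyn_op n), builds ops G' ->
     exists S : nat,
       ((S * w)%:R <= C%:R * (n%:R * (lg d' + lg (lg (n%:R : R)))))%R /\
       maintains_from_empty D w S ops (C * (m + n + nqueries ops)))
  /\
  (exists (S : nat) (M : memory),
     ((S * w)%:R <= C%:R * (n%:R * lg d'))%R /\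
     stores_degrees Q w S G' M C).
Proof.
(* The cube bounds [kappa.+1 ^ 2] from the dynamic cells times [kappa.+2] from [up_log_lglg]; 3000
   is the static 1500 times the 2 of [field_bits_lg]. *)
exists degrees, static_query, 32 => kappa; exists (3000 * kappa.+2 ^ 3).
move=> n w n_gt0 /and3P[w_ge n_le w_le] G G' sub m d'.
have m_le : #|edges G'| <= n * n by apply: edges_le; apply: graph_pairs.
have m'm : #|edges G'| <= m by apply: subset_leq_card.
have lg_l := field_bits_lg R #|edges G'| n_gt0; rewrite -/(avg_degree R G') -/d' in lg_l.
have lgd := lg_ge1 d'; have lgn := lg_ge1 (lg (n%:R : R)).
have nR : (0 <= n%:R :> R)%R by apply: ler0n.
set k := kappa.+2 in lg_l *.
have k_gt0 : 0 < k ^ 3 by rewrite expn_gt0.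
split.
  move=> ops bops; exists (dynamic_cells n w #|edges G'| (up_log 2 w)); split; last first.
    move=> M0 wM0; have [M1 [t1 [t2 [r [c1 r2 le]]]]] :=
      degrees_maintained n_gt0 w_ge n_le w_le bops wM0.
    exists M1, t1, t2, r; split=> //; apply: leq_trans le _; apply: leq_mul.
      by rewrite /k !expnS expn0; nia.
    by lia.
  have b0_lt : up_log 2 w < w.
    have : up_log 2 w <= w.-1; last by lia.
    by apply: up_log_min => //; have := ltn_expl w.-1 (isT : 1 < 2); lia.
  have := dynamic_cells_space n_gt0 w_ge n_le w_le m_le (up_logP w (isT : 1 < 2)) b0_lt.
  rewrite -(ler_nat R) => /le_trans; apply.
  have lg_b := up_log_lglg R n_gt0 w_le; rewrite -/k in lg_b.
  apply: (@le_trans _ _ ((100 * kappa.+1 ^ 2)%:R *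
    (n%:R * (k%:R * (lg d' + lg (lg (n%:R : R))))))%R).
    rewrite natrM ler_wpM2l ?ler0n // natrM ler_wpM2l // natrD mulrDr lerD //.
    apply: le_trans lg_l _; rewrite ler_wpM2r ?ler_nat //; exact: le_trans ler01 lgd.
  rewrite mulrCA [X in (_ <= X)%R]mulrCA ler_wpM2l // mulrA -natrM ler_wpM2r //.
    by rewrite addr_ge0 ?(le_trans ler01).
  by rewrite ler_nat /k !expnS expn0; nia.
have [M st] := degrees_stored G' n_gt0 w_ge n_le w_le.
exists (16 * (static_cells n w #|edges G'|).+1), M; split; last first.
  case: st => wM st; split=> // v; have [t le_t c] := st v.
  by exists t => //; apply: leq_trans le_t _; nia.
have := static_cells_space n_gt0 w_ge n_le w_le m_le.
rewrite -(ler_nat R) => /le_trans; apply.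
apply: (@le_trans _ _ ((1500 * kappa.+1)%:R * (n%:R * (2 * lg d')))%R).
  by rewrite natrM ler_wpM2l ?ler0n // natrM ler_wpM2l.
rewrite mulrCA [X in (_ <= X)%R]mulrCA ler_wpM2l // mulrA -natrM ler_wpM2r //.
  exact: le_trans ler01 lgd.
by rewrite ler_nat /k !expnS expn0; nia.
Qed.
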